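(* A unimodular fan $\Sigma$ is Ehrhart if and only if there exists a polynomial function $\mathrm{Ehr}_\Sigma$ on $\mathrm{PL}(\Sigma)$ satisfying the following sets of difference equations: (i) $D_m\mathrm{Ehr}_\Sigma=0$ for all $m\in M$; (ii) $\left(\prod_{\rho\in I}D_{x_\rho}\right)\mathrm{Ehr}_\Sigma=0$ for all $I\subseteq\Sigma(1)$ not spanning a cone of $\Sigma$; (iii) $\left(\left(\prod_{\rho\in I}D_{x_\rho}\right)\mathrm{Ehr}_\Sigma\right)(0)=1$ for all $I\subseteq\Sigma(1)$ spanning a cone of $\Sigma$.
   Context: $N$ is a lattice with dual $M=\mathrm{Hom}(N,\mathbb{Z})$, and $\Sigma$ is a unimodular (smooth), not necessarily complete, rational polyhedral fan in $N_{\mathbb{Q}}$; $\Sigma(1)$ is its set of rays and $u_\rho$ the primitive generator of $\rho$. $\mathrm{PL}(\Sigma)$ is the group of piecewise linear functions on the support of $\Sigma$, linear on each cone and integral at every $u_\rho$; it is free with basis the Courant functions $x_\rho$, $x_\rho(u_{\rho'})=\delta_{\rho\rho'}$. There is a map $M\to\mathrm{PL}(\Sigma)$, $m\mapsto\sum_\rho\langle m,u_\rho\rangle x_\rho$. For $v\in\mathrm{PL}(\Sigma)$ (or $v=m\in M$ via this map) $D_v=1-T^{-v}$, i.e. $(D_vh)(f)=h(f)-h(f-v)$. The empty set $I=\emptyset$ spans the cone $\{0\}$. Polynomial functions have rational coefficients. Star fan: for $\rho\in\Sigma(1)$, $\Sigma^\rho$ is the unimodular fan in $(N/\mathbb{Z}u_\rho)_{\mathbb{Q}}$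 consisting of the images of the cones of $\Sigma$ containing $\rho$. For $f\in\mathrm{PL}(\Sigma)$, $f^\rho$ denotes the class in $\mathrm{PL}(\Sigma^\rho)/\mathrm{Hom}(N/\mathbb{Z}u_\rho,\mathbb{Z})$ obtained by choosing $m\in M$ with $\langle m,u_\rho\rangle=f(u_\rho)$, restricting $f-m$ to the cones containing $\rho$, and passing to the quotient. Ehrhart fans (Chan–Clader–Klivans–Ross), defined recursively on dimension: the zero-dimensional fan is Ehrhart with Ehrhart function $1$. A unimodular fan $\Sigma$ of positive dimension is Ehrhart if (1) $\Sigma^\rho$ is Ehrhart for every $\rho\in\Sigma(1)$, and (2) there is a function $\mathrm{Ehr}_\Sigma\colon\mathrm{PL}(\Sigma)\to\mathbb{Z}$, invariant under translation by $M$, with $\mathrm{Ehr}_\Sigma(0)=1$ and $\mathrm{Ehr}_\Sigma(f)-\mathrm{Ehr}_\Sigma(f-x_\rho)=\mathrm{Ehr}_{\Sigma^\rho}(f^\rho)$ for all $f\in\mathrm{PL}(\Sigma)$, $\rho\in\Sigma(1)$. The function $\mathrm{Ehr}_\Sigma$ is then unique. *)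

(* Defs.v *)
From HB Require Import structures.
From mathcomp Require Import all_boot all_order all_algebra finmap.
From mathcomp Require Import boolp classical_sets functions cardinality.
From mathcomp Require mpoly.

Set Implicit Arguments.
Unset Strict Implicit.
Unset Printing Implicit Defensive.

Import Order.TTheory GRing.Theory Num.Theory.
Local Open Scope classical_set_scope.
Local Open Scope ring_scope.

(* Throughout, V stands for N_Q, a finite-dimensional rational vector space,
   and the lattice N is the subset of V formed by its points. *)

Section Fans.
Variable V : vectType rat.
Implicit Types (N sigma tau rho : set V) (Sigma : set (set V)).

(* Since V = N_Q, a Z-basis of N is also a Q-basis of V. *)
Definition lattice_basis N (b : seq V) : Prop :=
  basis_of fullv b /\
  N = [set v | exists c : 'I_(size b) -> int,
                 v = \sum_(i < size b) b`_i *~ c i].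

Definition lattice N : Prop := exists b, lattice_basis N b.

(* The dual lattice Hom(N, Z), as a subset of Hom(N_Q, Q). *)
Definition dual_lattice N : set 'Hom(V, rat^o) :=
  [set m | forall v, N v -> (m v : rat) \is a Num.int].

(* In particular cone [::] is {0}. *)
Definition cone (s : seq V) : set V :=
  [set v | exists c : 'I_(size s) -> rat,
             (forall i, 0 <= c i) /\ v = \sum_(i < size s) c i *: s`_i].

Definition unimodular_cone N sigma : Prop :=
  exists s t, lattice_basis N (s ++ t) /\ sigma = cone s.

Definition face tau sigma : Prop :=
  exists m : 'Hom(V, rat^o),
    (forall v, sigma v -> 0 <= (m v : rat)) /\
    tau = [set v | sigma v /\ m v = 0].

(* Unimodular cones are rational, polyhedral and strongly convex, so these
   conditions need not be required separately. *)
Record unimodular_fan N Sigma : Prop := UnimodularFan {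
  fan_finite : finite_set Sigma;
  fan_nonempty : Sigma !=set0;
  fan_unimodular : forall sigma, Sigma sigma -> unimodular_cone N sigma;
  fan_face : forall sigma tau, Sigma sigma -> face tau sigma -> Sigma tau;
  fan_inter : forall sigma tau, Sigma sigma -> Sigma tau ->
    face (sigma `&` tau) sigma /\ face (sigma `&` tau) tau }.

Definition support Sigma : set V := \bigcup_(sigma in Sigma) sigma.

(* Sigma(1). As fset_set is the empty set on infinite sets, this is meaningful
   for finite Sigma only. *)
Definition rays Sigma : {fset set V} :=
  fset_set [set rho | Sigma rho /\ exists2 u, u != 0 & rho = cone [:: u]].

(* u generates the semigroup of lattice points of the ray rho. *)
Definition is_primitive_generator N rho (u : V) : Prop :=
  [/\ N u, rho = cone [:: u]
    & forall v, N v -> rho v -> exists k : nat, v = u *+ k].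

(* In a unimodular fan every ray has exactly one primitive generator. *)
Definition prim N rho : V := xget 0 [set u | is_primitive_generator N rho u].

(* A function on the support of Sigma is encoded by its extension by 0 to all
   of V. *)
Definition is_PL N Sigma (f : V -> rat) : Prop :=
  [/\ forall v, ~ support Sigma v -> f v = 0,
      forall sigma, Sigma sigma ->
        exists l : 'Hom(V, rat^o), forall v, sigma v -> f v = l v
    & forall rho : rays Sigma, f (prim N (val rho)) \is a Num.int].

Definition PL_pred N Sigma : {pred (V -> rat)} :=
  fun f => `[< is_PL N Sigma f >].

Lemma PL_pred_zmod_closed N Sigma : zmod_closed (PL_pred N Sigma).
Proof.
split.
  apply/asboolP; split=> [//|sigma _|rho]; last exact: rpred0.
  by exists 0 => v _; rewrite zero_lfunE.
move=> f g /asboolP[f0 fl fZ] /asboolP[g0 gl gZ]; apply/asboolP; split.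
- by move=> v nv; rewrite /= !fctE f0 // g0 // subr0.
- move=> sigma Ss; have [l lP] := fl _ Ss; have [k kP] := gl _ Ss.
  exists (l - k) => v sv.
  by rewrite !fctE lP // kP // add_lfunE opp_lfunE.
- by move=> rho; rewrite !fctE rpredB.
Qed.

HB.instance Definition _ N Sigma :=
  GRing.isZmodClosed.Build (V -> rat) (PL_pred N Sigma)
    (@PL_pred_zmod_closed N Sigma).

Record PL N Sigma : Type := MkPL {
  PL_fun :> V -> rat;
  PL_funP : PL_fun \in PL_pred N Sigma }.

HB.instance Definition _ N Sigma := [isSub for @PL_fun N Sigma].
HB.instance Definition _ N Sigma := [Choice of PL N Sigma by <:].
HB.instance Definition _ N Sigma :=
  [SubChoice_isSubZmodule of PL N Sigma by <:].

(* In a unimodular fan the piecewise linear function x_rho with these values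
   exists and is unique. *)
Definition courant N Sigma (rho : rays Sigma) : PL N Sigma :=
  xget 0 [set x : PL N Sigma |
    forall rho' : rays Sigma, x (prim N (val rho')) = (rho' == rho)%:R].

(* The map M -> PL(Sigma). For m in the dual lattice the value of m at a
   primitive generator is an integer, and Num.floor only retypes it. *)
Definition PL_of_dual N Sigma (m : 'Hom(V, rat^o)) : PL N Sigma :=
  \sum_(rho : rays Sigma)
    courant N rho *~ Num.floor (m (prim N (val rho)) : rat).

Definition spans_cone N Sigma (I : {set rays Sigma}) : Prop :=
  Sigma (cone [seq prim N (val rho) | rho : rays Sigma in I]).

Definition diff_op (A W : zmodType) (v : A) (h : A -> W) : A -> W :=
  fun f => h f - h (f - v).

(* The operator \prod_(rho in I) D_(x_rho); its factors commute. *)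
Definition courant_diff N Sigma (I : {set rays Sigma}) :
    (PL N Sigma -> rat) -> (PL N Sigma -> rat) :=
  \big[(fun A B => A \o B)/id]_(rho : rays Sigma | rho \in I)
    diff_op (courant N rho).

(* The coordinates of f in the basis of Courant functions are its values at
   the primitive generators. *)
Definition polynomial_function N Sigma (h : PL N Sigma -> rat) : Prop :=
  exists p : mpoly.mpoly #|{: rays Sigma}| rat,
    forall f, h f = mpoly.meval (fun i => f (prim N (val (enum_val i)))) p.

End Fans.

Section StarFans.
Variable V : vectType rat.
Implicit Types (N rho : set V) (Sigma : set (set V)).

(* The quotient of V by the line of u, realized on a complement of this line. *)
Definition quot_space (u : V) : vectType rat := subvs_of (<[u]>^C)%VS.

Definition quot_map (u : V) (v : V) : quot_space u :=
  vsproj (<[u]>^C)%VS (daddv_pi (<[u]>^C)%VS <[u]>%VS v).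

(* N / Z u for a primitive vector u, whose line meets N in Z u. *)
Definition quot_lattice N (u : V) : set (quot_space u) := quot_map u @` N.

Definition star Sigma rho (u : V) : set (set (quot_space u)) :=
  [set quot_map u @` sigma |
     sigma in [set sigma | Sigma sigma /\ rho `<=` sigma]].

Definition star_PL N Sigma (rho : rays Sigma) : zmodType :=
  PL (quot_lattice N (u := prim N (val rho)))
     (star Sigma (val rho) (u := prim N (val rho))).

(* g is a representative of the class f^rho. *)
Definition star_class N Sigma (rho : rays Sigma)
    (f : PL N Sigma) (g : star_PL N rho) : Prop :=
  exists m, [/\ dual_lattice N m, m (prim N (val rho)) = f (prim N (val rho))
    & forall sigma, Sigma sigma -> val rho `<=` sigma ->
        forall v, sigma v -> g (quot_map (prim N (val rho)) v) = f v - m v].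

End StarFans.

(* ehrhart_function h: the fan Sigma is Ehrhart, with Ehrhart function h. As h'
   below is itself invariant under translation by Hom(N / Z u_rho, Z), its value
   on the class f^rho is its value at any representative. *)
Inductive ehrhart_function : forall (V : vectType rat) (N : set V)
    (Sigma : set (set V)), (PL N Sigma -> int) -> Prop :=
| Ehrhart_dim0 (V : vectType rat) (N : set V) (Sigma : set (set V))
    (h : PL N Sigma -> int) :
    Sigma = [set [set 0]] ->
    (forall f, h f = 1) ->
    ehrhart_function h
| Ehrhart_dim_pos (V : vectType rat) (N : set V) (Sigma : set (set V))
    (h : PL N Sigma -> int)
    (h' : forall rho : rays Sigma, star_PL N rho -> int) :
    Sigma <> [set [set 0]] ->
    (forall rho, ehrhart_function (h' rho)) ->
    (forall m f, dual_lattice N m -> h (f + PL_of_dual N Sigma m) = h f) ->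
    h 0 = 1 ->
    (forall f (rho : rays Sigma) (g : star_PL N rho), star_class f g ->
       h f - h (f - courant N rho) = h' rho g) ->
    ehrhart_function h.

Definition Ehrhart (V : vectType rat) (N : set V) (Sigma : set (set V)) : Prop :=
  exists h : PL N Sigma -> int, ehrhart_function h.

(* Main.v *)
(* Evaluation at primitive generators identifies PL(Sigma) with Z^(Sigma(1)),
   and identifies a class of PL(Sigma^rho) modulo linear functions with the
   values on the link of rho.  A set J of rays of the star spans a cone exactly
   when rho together with the corresponding rays of Sigma spans one.  Hence, if
   D_(x_rho) h is the pullback of a function h' on the star, then the equations
   (ii) and (iii) for h and the sets I containing rho are precisely those for
   h' and I \ {rho}: D_(x_rho') with rho' outside the link kills a pullback.

   If Sigma is Ehrhart, induction along the recursive definition gives the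
   equations; polynomiality follows because a function on Z^n all of whose
   first differences are polynomial is polynomial.  Conversely, (i) and (ii)
   for the pairs {rho, rho'} show that D_(x_rho) h descends to the star, where
   it again satisfies the equations, so that induction on the number of rays
   applies; h is integral because h(0) = 1 and its first differences are. *)

Require Import Defs.
From HB Require Import structures.
From mathcomp Require Import all_boot all_order all_algebra finmap.
From mathcomp Require Import boolp classical_sets functions cardinality.
From mathcomp Require mpoly.

Set Implicit Arguments.
Unset Strict Implicit.
Unset Printing Implicit Defensive.

Import Order.TTheory GRing.Theory Num.Theory.
Local Open Scope classical_set_scope.
Local Open Scope ring_scope.

(** * Cones and lattice bases *)

(** [cone] and [lattice_basis] index coefficients by ordinals. As [s] has no repetitions, they can
    be indexed by the entries themselves, with [k0] as a value off [s] that the sum never sees. *)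
Lemma sum_index_of_ord (T : eqType) (K : Type) (k0 : K) (W : nmodType)
    (op : T -> K -> W) (s : seq T) (x0 : T) (n : nat) (c : 'I_n -> K) :
  uniq s -> n = size s ->
  \sum_(i < n) op (nth x0 s i) (c i) =
  \sum_(x <- s) op x (oapp c k0 (insub (index x s))).
Proof.
move=> us ns; subst n; rewrite (big_nth x0) big_mkord; apply: eq_bigr => i _.
by rewrite index_uniq // valK.
Qed.

Section Cones.
Variable V : vectType rat.

Lemma cone_mapP (T : eqType) (s : seq T) (F : T -> V) v : uniq s ->
  cone (map F s) v <->
  exists c : T -> rat, (forall x, 0 <= c x) /\ v = \sum_(x <- s) c x *: F x.
Proof.
move=> us; split=> [[c [c0 ->]]|[c [c0 ->]]].
  exists (fun x => oapp c 0 (insub (index x s))); split=> [x|].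
    by case: insubP => //= i.
  case: s us c c0 => [|x0 s] us c c0.
    by rewrite big_nil big_ord0.
  rewrite -(sum_index_of_ord 0 (fun x k => k *: F x) x0) ?size_map //.
  apply: eq_bigr => i _; congr (_ *: _).
  by rewrite (nth_map x0) // -(size_map F).
case: s us => [|x0 s] us.
  by exists (fun=> 0); rewrite big_nil big_ord0.
exists (fun i => c (nth x0 (x0 :: s) i)); split=> //.
rewrite (big_nth x0) -(size_map F) big_mkord; apply: eq_bigr => i _.
by rewrite (nth_map x0) // -(size_map F).
Qed.

Lemma coneP (s : seq V) v : uniq s ->
  cone s v <->
  exists c : V -> rat, (forall x, 0 <= c x) /\ v = \sum_(x <- s) c x *: x.
Proof. by move=> us; rewrite -{1}(map_id s); apply: cone_mapP. Qed.

Lemma cone1P (u v : V) : cone [:: u] v <-> exists2 k : rat, 0 <= k & v = k *: u.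
Proof.
rewrite coneP //; split=> [[c [c0 ->]]|[k k0 ->]].
  by exists (c u); rewrite ?big_seq1.
by exists (fun=> k); rewrite big_seq1.
Qed.

Lemma cone1_scale (u : V) k : 0 < k -> cone [:: k *: u] = cone [:: u].
Proof.
move=> k0; apply/seteqP; split=> v /cone1P[a a0 ->]; apply/cone1P.
  by exists (a * k); rewrite ?scalerA // mulr_ge0 // ltW.
exists (a / k); first by rewrite divr_ge0 // ltW.
by rewrite scalerA divfK // gt_eqF.
Qed.

Lemma cone1_eq (u w : V) : u != 0 -> cone [:: w] u -> cone [:: w] = cone [:: u].
Proof.
move=> u0 /cone1P[k]; rewrite le0r => /orP[/eqP->|k0 uE].
  by rewrite scale0r => uE; rewrite uE eqxx in u0.
by rewrite uE cone1_scale.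
Qed.

Lemma cone_perm (s t : seq V) : uniq s -> perm_eq s t -> cone s = cone t.
Proof.
move=> us st; have ut : uniq t by rewrite -(perm_uniq st).
apply/seteqP; split=> v /coneP-/(_ ltac:(done))[c [c0 ->]]; apply/coneP => //;
  exists c; split=> //; first exact: perm_big.
by apply: perm_big; rewrite perm_sym.
Qed.

Lemma cone_closed_comb (s : seq V) v w a b : cone s v -> cone s w ->
  0 <= a -> 0 <= b -> cone s (a *: v + b *: w).
Proof.
move=> [c [c0 ->]] [d [d0 ->]] a0 b0.
exists (fun i => a * c i + b * d i); split=> [i|].
  by rewrite addr_ge0 ?mulr_ge0.
rewrite !scaler_sumr -big_split; apply: eq_bigr => i _ /=.
by rewrite scalerDl !scalerA.
Qed.

Lemma cone_0 (s : seq V) : cone s 0.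
Proof. by exists (fun=> 0); split=> //; rewrite big1 // => i;
  rewrite scale0r. Qed.

Lemma cone_mem (s : seq V) x : x \in s -> cone s x.
Proof.
move=> xs; have lt : (index x s < size s)%N by rewrite index_mem.
exists (fun i => (i == Ordinal lt)%:R); split=> [i|]; first exact: ler0n.
rewrite (bigD1 (Ordinal lt)) //= eqxx scale1r nth_index // big1 ?addr0 //.
by move=> i /negbTE->; rewrite scale0r.
Qed.

Lemma cone_scale (s : seq V) x k : 0 <= k -> cone s x -> cone s (k *: x).
Proof.
by move=> k0 sx; rewrite -[k *: x]addr0 -(scaler0 _ 0);
  apply: cone_closed_comb => //; exact: cone_0.
Qed.

Lemma cone1_sub (s : seq V) u : cone s u -> cone [:: u] `<=` cone s.
Proof. by move=> su v /cone1P[k k0 ->]; exact: cone_scale. Qed.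

Lemma cone_nilE : cone [::] = [set (0 : V)].
Proof.
apply/seteqP; split=> [v /coneP-/(_ isT)[c [_ ->]]|v ->]; last exact: cone_0.
by rewrite big_nil.
Qed.

End Cones.

(** * Lattice bases and their dual functionals *)

Section Lattices.
Variables (V : vectType rat) (N : set V).

Lemma lattice_basisP (b : seq V) : lattice_basis N b ->
  forall v, N v <-> exists c : V -> int, v = \sum_(x <- b) x *~ c x.
Proof.
move=> [bb ->] v; have ub := free_uniq (basis_free bb); split=> [[c ->]|[c ->]].
  exists (fun x => oapp c 0 (insub (index x b))).
  by rewrite -(sum_index_of_ord 0 (fun x k => x *~ k) 0).
exists (fun i => c b`_i); by rewrite (big_nth 0) big_mkord.
Qed.

Lemma lattice_basis_uniq (s t : seq V) : lattice_basis N (s ++ t) -> uniq s.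
Proof. by case=> /basis_free/free_uniq; rewrite cat_uniq => /andP[]. Qed.

Lemma mk_lattice_basis (b : seq V) : basis_of fullv b ->
  (forall v, N v <-> exists c : V -> int, v = \sum_(x <- b) x *~ c x) ->
  lattice_basis N b.
Proof.
move=> bb NP; split=> //; have ub := free_uniq (basis_free bb).
apply/seteqP; split=> v; rewrite /= NP.
  case=> c ->; exists (fun i => c b`_i); by rewrite (big_nth 0) big_mkord.
case=> c ->; exists (fun x => oapp c 0 (insub (index x b))).
by rewrite -(sum_index_of_ord 0 (fun x k => x *~ k) 0).
Qed.

Lemma lattice_basis_perm (b b' : seq V) : perm_eq b b' ->
  lattice_basis N b -> lattice_basis N b'.
Proof.
move=> pb lb; apply: mk_lattice_basis.
  by rewrite -(perm_basis _ pb); case: lb.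
move=> v; rewrite (lattice_basisP lb); split=> -[c ->]; exists c;
  apply: perm_big => //; by rewrite perm_sym.
Qed.

Lemma lattice_mem (b : seq V) x : lattice_basis N b -> x \in b -> N x.
Proof.
move=> lb xb; apply/(lattice_basisP lb); exists (fun y => (y == x)%:R).
have ub : uniq b by case: lb => /basis_free/free_uniq.
rewrite (bigD1_seq x) //= eqxx mulr1z big1 ?addr0 //.
by move=> y /negbTE->; rewrite mulr0z.
Qed.

Lemma dual_basis (b : seq V) : lattice_basis N b ->
  exists m : V -> 'Hom(V, rat^o), (forall x, dual_lattice N (m x)) /\
    forall x y, x \in b -> y \in b -> m x y = (x == y)%:R.
Proof.
move=> lb; have [bb _] := lb; have fb := basis_free bb; have ub := free_uniq fb.
pose X := in_tuple b.
(* These are the coordinate functionals. The default 0 off [b] keeps [m x] in the dual lattice for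
   every vector [x]. *)
pose m x : 'Hom(V, rat^o) := if insub (index x b) is Some i
  then linfun (coord X i : V -> rat^o) else 0.
have mP x y : x \in b -> y \in b -> m x y = (x == y)%:R.
  move=> xb yb; rewrite /m.
  have ltx : (index x b < size b)%N by rewrite index_mem.
  have lty : (index y b < size b)%N by rewrite index_mem.
  rewrite insubT lfunE /= -{1}(nth_index 0 yb).
  rewrite -[index y b]/(val (Ordinal lty)) (coord_free _ _ (_ : free X)) //.
  congr (nat_of_bool _)%:R; rewrite -val_eqE SubK /= eq_sym.
  apply/eqP/eqP => [eqi|->//].
  by rewrite -(nth_index 0 xb) eqi nth_index.
have mZ x y : y \in b -> (m x y : rat) \is a Num.int.
  move=> yb; have [xb|xb] := boolP (x \in b); first by rewrite mP.
  by rewrite /m insubF ?zero_lfunE ?rpred0 // index_mem; exact: negbTE.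
exists m; split=> // x v /(lattice_basisP lb)[c ->].
rewrite linear_sum big_seq; apply: rpred_sum => y yb.
by rewrite raddfMz; apply: rpredMz; apply: mZ.
Qed.
End Lattices.

(** * Rays of a unimodular fan *)

Lemma functionalZ (V : vectType rat) (m : 'Hom(V, rat^o)) (k : rat) v :
  m (k *: v) = k * (m v : rat) :> rat.
Proof. by rewrite linearZ. Qed.

Section PrimitiveGenerators.
Variables (V : vectType rat) (N : set V).

(** The dual functional of [x] reads off [k] from a lattice point [k *: x], so [k] is an integer. *)
Lemma primitive_of_basis b x : lattice_basis N b -> x \in b ->
  is_primitive_generator N (cone [:: x]) x.
Proof.
move=> lb xb; split=> // [|v Nv /cone1P[k k0 vE]];
  first exact: lattice_mem lb xb.
have [m [mN mE]] := dual_basis lb.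
have : (m x v : rat) \is a Num.int by apply: mN.
rewrite vE functionalZ mE // eqxx mulr1 => kZ.
have /natrP[n ->] : k \is a Num.nat by rewrite natrEint kZ.
by exists n; rewrite scaler_nat.
Qed.

Lemma primitive_unique rho x y : x != 0 ->
  is_primitive_generator N rho x -> is_primitive_generator N rho y -> x = y.
Proof.
move=> x0 [Nx rx xP] [Ny ry yP].
have [k xE] : exists k : nat, x = y *+ k by apply: yP; rewrite // rx;
  apply: cone_mem; rewrite inE.
have [l yE] : exists k : nat, y = x *+ k by apply: xP; rewrite // ry;
  apply: cone_mem; rewrite inE.
have : (l * k)%N == 1%N.
  have /eqP : x *+ (l * k) = x *+ 1 by rewrite mulrnA -yE -xE.
  by rewrite -!scaler_nat -subr_eq0 -scalerBl scaler_eq0 (negbTE x0) orbF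
    subr_eq0 eqr_nat.
by rewrite muln_eq1 => /andP[/eqP l1 _]; rewrite yE l1.
Qed.

(** The sum of the dual functionals of the generators outside [A] is nonnegative on the cone. It
    vanishes exactly where all coefficients at those generators do. *)
Lemma face_cone_filter (s t : seq V) (A : pred V) : lattice_basis N (s ++ t) ->
  face (cone (filter A s)) (cone s).
Proof.
move=> lb; have [m [mN mE]] := dual_basis lb.
have us := lattice_basis_uniq lb.
have mc (c : V -> rat) (y : V) : y \in s ->
  (m y (\sum_(x <- s) c x *: x) : rat) = c y.
  move=> ys; rewrite linear_sum /= (bigD1_seq y) //= big1_seq =>
    [|x /andP[xy xs]].
    by rewrite addr0 functionalZ mE ?mem_cat ?ys // eqxx mulr1.
  by rewrite functionalZ mE ?mem_cat ?ys ?xs // eq_sym (negbTE xy) mulr0.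
exists (\sum_(y <- s | ~~ A y) m y).
have sumE (c : V -> rat) : ((\sum_(y <- s | ~~ A y) m y)
  (\sum_(x <- s) c x *: x) : rat)
    = \sum_(y <- s | ~~ A y) c y.
  rewrite sum_lfunE big_seq_cond [RHS]big_seq_cond; apply: eq_bigr =>
    y /andP[ys _].
  exact: mc.
split=> [v /(coneP _ us)[c [c0 ->]]|].
  by rewrite sumE; apply: sumr_ge0.
apply/seteqP; split=> v.
  move=> /coneP-/(_ (filter_uniq _ us))[c [c0 vE]].
  have {}vE : v = \sum_(x <- s) (if A x then c x else 0) *: x.
    rewrite vE big_filter big_mkcond; apply: eq_bigr => x _.
    by case: (A x); rewrite ?scale0r.
  split.
    apply/coneP => //; exists (fun x => if A x then c x else 0); split=> // x.
    by case: ifP.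
  by rewrite vE sumE big1 // => y /negbTE Ay; rewrite Ay.
move=> [/(coneP _ us)[c [c0 ->]]]; rewrite sumE => /eqP.
rewrite psumr_eq0 // => /allP cA; apply/coneP; first exact: filter_uniq.
exists c; split=> //; rewrite big_filter [RHS]big_mkcond /=.
apply: eq_big_seq => x xs; case: ifPn => // Ax.
by have /implyP/(_ Ax)/eqP-> := cA x xs; rewrite scale0r.
Qed.

End PrimitiveGenerators.

(** * Cones of the fan as spans of sets of rays *)

Section FanCones.
Variables (V : vectType rat) (N : set V) (Sigma : set (set V)).
Hypothesis uf : unimodular_fan N Sigma.
Implicit Types (r : rays Sigma) (I J : {set rays Sigma}).

Lemma rays_mem rho :
  rho \in rays Sigma <-> Sigma rho /\ exists2 u, u != 0 & rho = cone [:: u].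
Proof.
rewrite /rays in_fset_set ?inE //.
by apply: sub_finite_set (fan_finite uf) => x [].
Qed.

Lemma ray_intro rho u : Sigma rho -> u != 0 -> rho = cone [:: u] ->
  exists r, val r = rho.
Proof.
move=> Sr u0 rE; have rR : rho \in rays Sigma by apply/rays_mem; split=> //;
  exists u.
by exists (FSetSub rR).
Qed.

(** By unimodularity the ray is the cone of a part [s] of a lattice basis. Any entry of [s] is
    nonzero and lies on the ray, so it generates the ray and is primitive; hence the choice in
    [prim] does not fall back on 0. *)
Lemma prim_spec r : is_primitive_generator N (val r) (prim N (val r)) /\
  prim N (val r) != 0.
Proof.
have /rays_mem[Sr [u0 u0n rE]] := valP r.
have [s [t [lb sE]]] := fan_unimodular uf Sr.
have [x xs] : exists x, x \in s.
  case: s lb sE => [|x s] lb sE; last by exists x; rewrite inE eqxx.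
  have : val r u0 by rewrite rE; apply: cone_mem; rewrite inE.
  by rewrite sE cone_nilE /= => u00; rewrite u00 eqxx in u0n.
have x0 : x != 0 by case: lb => bb _; apply: (basis_not0 bb);
  rewrite mem_cat xs.
have xE : val r = cone [:: x].
  by rewrite rE; apply: cone1_eq => //; rewrite -rE sE; apply: cone_mem.
have px : is_primitive_generator N (val r) x.
  by rewrite xE; apply: primitive_of_basis lb _; rewrite mem_cat xs.
have pp : is_primitive_generator N (val r) (prim N (val r)).
  by rewrite /prim; case: xgetP => [y _ //|/(_ x)].
by split=> //; rewrite -(primitive_unique x0 px pp).
Qed.

Lemma prim_neq0 r : prim N (val r) != 0.
Proof. by have [] := prim_spec r. Qed.

Lemma prim_cone r : val r = cone [:: prim N (val r)].
Proof. by have [[]] := prim_spec r. Qed.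

Lemma prim_mem r : val r (prim N (val r)).
Proof. by rewrite {1}prim_cone; apply: cone_mem; rewrite inE. Qed.

Lemma ray_memP r v : val r v <->
  exists2 k : rat, 0 <= k & v = k *: prim N (val r).
Proof. by rewrite {1}prim_cone; apply: cone1P. Qed.

Lemma prim_lattice r : N (prim N (val r)).
Proof. by have [[]] := prim_spec r. Qed.

Lemma prim_inj : injective (fun r => prim N (val r)).
Proof. by move=> r r' e; apply: val_inj;
  rewrite prim_cone [RHS]prim_cone e. Qed.

Lemma ray_Sigma r : Sigma (val r).
Proof. by have /rays_mem[] := valP r. Qed.

Lemma primE r x : x != 0 -> is_primitive_generator N (val r) x ->
  prim N (val r) = x.
Proof. by move=> x0 px; have [pp _] := prim_spec r;
  rewrite -(primitive_unique x0 px pp). Qed.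

(** The generator [x] alone spans a face of the cone, hence a ray of the fan. *)
Lemma ray_of_basis s t x : Sigma (cone s) -> lattice_basis N (s ++ t) ->
  x \in s -> exists r, prim N (val r) = x.
Proof.
move=> Ss lb xs.
have us := lattice_basis_uniq lb.
have x0 : x != 0 by case: lb => bb _; apply: (basis_not0 bb);
  rewrite mem_cat xs.
have : Sigma (cone [:: x]).
  apply: (fan_face uf Ss); rewrite -(filter_pred1_uniq us xs).
  exact: face_cone_filter lb.
move=> /ray_intro-/(_ x x0 erefl)[r rE]; exists r; apply: primE => //.
by rewrite rE; apply: primitive_of_basis lb _; rewrite mem_cat xs.
Qed.

Definition span_cone I := cone [seq prim N (val r) | r : rays Sigma in I].

Lemma span_coneP I v : span_cone I v <->
  exists c : rays Sigma -> rat, (forall r, 0 <= c r) /\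
    v = \sum_(r in I) c r *: prim N (val r).
Proof.
rewrite /span_cone /image_mem cone_mapP ?enum_uniq //.
by split=> -[c [c0 vE]]; exists c; split=> //; rewrite vE big_enum.
Qed.

Lemma mem_prims I r : r \in I ->
  prim N (val r) \in [seq prim N (val r) | r : rays Sigma in I].
Proof. by move=> rI; apply/fintype.imageP; exists r. Qed.

Lemma span_cone_prim I r : r \in I -> span_cone I (prim N (val r)).
Proof. by move=> rI; apply: cone_mem; apply: mem_prims. Qed.

(* The ray r, being its intersection with the cone of I, is a face of it. *)
Lemma mem_of_span_cone I r : spans_cone N I ->
  span_cone I (prim N (val r)) -> r \in I.
Proof.
move=> SI Ir; have rI : val r `<=` span_cone I.
  by rewrite prim_cone; apply: cone1_sub.
have [_] := fan_inter uf (ray_Sigma r) SI.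
rewrite (setIidl rI) => -[m [m0 mE]].
have [c [c0 rE]] := (span_coneP I _).1 Ir.
have mr : m (prim N (val r)) = 0.
  by have := prim_mem r; rewrite {1}mE => -[].
(* The functional [m] is nonnegative at the generators and vanishes at their combination
   [prim N (val r)], so it vanishes at a generator with nonzero coefficient. That generator then
   lies on [r], which forces the two rays to coincide. *)
have [r' r'I cr'] : exists2 r', r' \in I & c r' != 0.
  apply: contrapT => nex; have := prim_neq0 r; rewrite rE big1 ?eqxx // =>
    r' r'I.
  have [->|cr'] := eqVneq (c r') 0; first by rewrite scale0r.
  by case: nex; exists r'.
have mr' : m (prim N (val r')) = 0.
  move: mr; rewrite rE linear_sum /= => /eqP.
  rewrite psumr_eq0 => [|i iI]; last first.
    by rewrite functionalZ; apply: mulr_ge0 => //; apply: m0;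
      exact: span_cone_prim.
  move=> /allP/(_ r' (mem_index_enum _)) /implyP/(_ r'I).
  by rewrite functionalZ mulf_eq0 (negbTE cr') /= => /eqP.
have : val r (prim N (val r')).
  by rewrite mE; split=> //; exact: span_cone_prim.
rewrite prim_cone => /(cone1_eq (prim_neq0 r')).
by rewrite -!prim_cone => /val_inj->.
Qed.

Lemma span_cone_inj I J : spans_cone N I -> spans_cone N J ->
  span_cone I = span_cone J -> I = J.
Proof.
move=> SI SJ IJ; apply/setP => r; apply/idP/idP => rI;
  apply: mem_of_span_cone => //.
  by rewrite -IJ; exact: span_cone_prim.
by rewrite IJ; exact: span_cone_prim.
Qed.

Lemma cone_span_cone sigma s t : Sigma sigma -> lattice_basis N (s ++ t) ->
  sigma = cone s -> exists2 I : {set rays Sigma},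
    perm_eq s [seq prim N (val r) | r : rays Sigma in I]
    & sigma = span_cone I.
Proof.
move=> Ss lb sE; pose I : {set rays Sigma} :=
  [set r | prim N (val r) \in s]%SET.
have us := lattice_basis_uniq lb.
have ps : perm_eq s [seq prim N (val r) | r : rays Sigma in I].
  apply: uniq_perm => //.
    rewrite map_inj_in_uniq ?enum_uniq // => r r' _ _; exact: prim_inj.
  move=> x; apply/idP/idP => [xs|/fintype.imageP[r]]; last by rewrite inE =>
    rs ->.
  have [|r rx] := ray_of_basis _ lb xs; first by rewrite -sE.
  by apply/fintype.imageP; exists r; rewrite ?inE rx.
by exists I => //; rewrite sE; apply: cone_perm.
Qed.

Lemma fan_span_cone sigma : Sigma sigma ->
  exists2 I, spans_cone N I & sigma = span_cone I.
Proof.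
move=> Ss; have [s [t [lb sE]]] := fan_unimodular uf Ss.
have [I _ IE] := cone_span_cone Ss lb sE; exists I => //.
by rewrite /spans_cone -/(span_cone I) -IE.
Qed.

(** Unimodularity provides a partial basis consisting of the generators of some set [J] of rays with
    the same cone. A cone of the fan determines its rays, so [J] is [I]. *)
Lemma spans_basis I : spans_cone N I ->
  exists t, lattice_basis N ([seq prim N (val r) | r : rays Sigma in I] ++ t).
Proof.
move=> SI; have [s [t [lb sE]]] := fan_unimodular uf SI.
have [J ps JE] := cone_span_cone SI lb sE.
have SJ : spans_cone N J by rewrite /spans_cone -/(span_cone J) -JE.
have -> : I = J by apply: span_cone_inj.
by exists t; apply: lattice_basis_perm lb; rewrite perm_cat2r.
Qed.

Lemma spans_dual I : spans_cone N I -> exists m : rays Sigma -> 'Hom(V, rat^o),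
  (forall r, dual_lattice N (m r)) /\
  forall r r', r \in I -> r' \in I -> m r (prim N (val r')) = (r' == r)%:R.
Proof.
move=> /spans_basis[t /dual_basis[m [mN mE]]];
  exists (fun r => m (prim N (val r))).
split=> // r r' rI r'I; rewrite mE ?mem_cat ?mem_prims //.
by rewrite (inj_eq prim_inj) eq_sym.
Qed.

Lemma spans_sub I J : J \subset I -> spans_cone N I -> spans_cone N J.
Proof.
move=> /fintype.subsetP JI SI; have [t lb] := spans_basis SI.
pose A := [pred x | x \in [seq prim N (val r) | r : rays Sigma in J]].
apply: (fan_face uf SI); rewrite /spans_cone.
have := face_cone_filter A lb; congr face; apply: cone_perm.
  exact: filter_uniq (lattice_basis_uniq lb).
apply: uniq_perm.
- exact: filter_uniq (lattice_basis_uniq lb).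
- rewrite map_inj_in_uniq ?enum_uniq // => r r' _ _; exact: prim_inj.
move=> x; rewrite mem_filter /=; apply/andP/idP => [[]//|xJ]; split=> //.
by case/fintype.imageP: xJ => r rJ ->; apply/mem_prims/JI.
Qed.

Lemma spans0 : spans_cone N (finset.set0 : {set rays Sigma}).
Proof.
have [sigma /fan_span_cone[I SI _]] := fan_nonempty uf.
by apply: (spans_sub _ SI); exact: finset.sub0set.
Qed.

End FanCones.

(** * Piecewise linear functions *)

Section PiecewiseLinear.
Variables (V : vectType rat) (N : set V) (Sigma : set (set V)).

Lemma PL_D (f g : PL N Sigma) v : (f + g) v = f v + g v.
Proof. by []. Qed.

Lemma PL_B (f g : PL N Sigma) v : (f - g) v = f v - g v.
Proof. by []. Qed.

Lemma PL_sum (T : Type) (s : seq T) (P : pred T) (F : T -> PL N Sigma) v :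
  (\sum_(i <- s | P i) F i) v = \sum_(i <- s | P i) F i v.
Proof. by elim/big_rec2: _ => // i y x _ <-. Qed.

Lemma PL_Mz (f : PL N Sigma) (k : int) v : (f *~ k) v = f v *~ k.
Proof.
have Mn n : (f *+ n) v = f v *+ n.
  by elim: n => // n IH; rewrite !mulrS PL_D IH.
case: k => n; first exact: Mn.
by rewrite !NegzE !mulrNz -!pmulrn -Mn.
Qed.

Lemma PL_int (f : PL N Sigma) (r : rays Sigma) : f (prim N (val r)) \is a
  Num.int.
Proof. by case: f => f /= /asboolP[_ _ /(_ r)]. Qed.

Hypothesis uf : unimodular_fan N Sigma.
Implicit Types (r : rays Sigma) (I J : {set rays Sigma}) (f g : PL N Sigma).
Implicit Types (a : rays Sigma -> rat).

Lemma spans1 r : spans_cone N [set r]%SET.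
Proof.
rewrite /spans_cone /image_mem enum_set1 /= -(prim_cone uf);
  exact: (ray_Sigma uf).
Qed.

Lemma spans_linear I a : spans_cone N I ->
  exists l : 'Hom(V, rat^o), forall r, r \in I -> l (prim N (val r)) = a r.
Proof.
move=> /(spans_dual uf)[m [_ mE]]; exists (\sum_(r in I) a r *: m r) => r rI.
rewrite sum_lfunE (bigD1 r) //= big1 => [|r' /andP[r'I r'r]].
  by rewrite scale_lfunE mE // eqxx addr0 [_ *: _]mulr1.
by rewrite scale_lfunE mE // eq_sym (negbTE r'r) scaler0.
Qed.

Lemma linear_eq_on_span_cone I (l l' : 'Hom(V, rat^o)) v :
  (forall r, r \in I -> l (prim N (val r)) = l' (prim N (val r))) ->
  span_cone N I v -> l v = l' v.
Proof.
move=> ll' /span_coneP[c [_ ->]]; rewrite !linear_sum.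
by apply: eq_bigr => r rI; rewrite !linearZ /= ll'.
Qed.

(** The intersection of the two cones is itself a cone of the fan. Its rays lie in both cones, hence
    belong to both sets. *)
Lemma span_cone_inter I J v : spans_cone N I -> spans_cone N J ->
  span_cone N I v -> span_cone N J v ->
  exists K : {set rays Sigma}, [/\ K \subset I, K \subset J & span_cone N K v].
Proof.
move=> SI SJ Iv Jv; have [fI _] := fan_inter uf SI SJ.
have [K SK KE] := fan_span_cone uf (fan_face uf SI fI).
have Kr r : r \in K -> span_cone N I (prim N (val r)) /\
  span_cone N J (prim N (val r)).
  by move=> /(span_cone_prim N); rewrite -KE.
exists K; split; last by rewrite -KE.
  by apply/fintype.subsetP => r /Kr[Ir _]; apply: (mem_of_span_cone uf SI).
by apply/fintype.subsetP => r /Kr[_ Jr]; apply: (mem_of_span_cone uf SJ).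
Qed.

(** The piecewise linear function with value [a r] at the generator of [r]. The default 0 is taken
    off the support, in line with the encoding of [PL]. *)
Definition interpolation a : V -> rat := fun v => xget 0
  [set y | exists I (l : 'Hom(V, rat^o)), [/\ spans_cone N I, span_cone N I v,
     forall r, r \in I -> l (prim N (val r)) = a r & y = l v]].

(** The value does not depend on the chosen cone: two cones through [v] share a cone through [v], on
    whose generators both linear functions are given by [a]. *)
Lemma interpolationE a I (l : 'Hom(V, rat^o)) v :
  spans_cone N I -> span_cone N I v ->
  (forall r, r \in I -> l (prim N (val r)) = a r) -> interpolation a v = l v.
Proof.
move=> SI Iv lE; rewrite /interpolation; case: xgetP => [y _|/(_ (l v))[]];
  last first.
  by exists I, l.
move=> [J [l' [SJ Jv l'E ->]]].
have [K [/fintype.subsetP KI /fintype.subsetP KJ]] := span_cone_inter SI SJ Iv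
  Jv.
by apply: linear_eq_on_span_cone => r rK; rewrite lE ?l'E ?KI ?KJ.
Qed.

Lemma interpolation_prim a r : interpolation a (prim N (val r)) = a r.
Proof.
have [l lE] := spans_linear a (spans1 r).
rewrite (interpolationE (spans1 r) _ lE) ?lE ?inE //.
by apply: span_cone_prim; rewrite inE.
Qed.

Lemma interpolation_PL a : (forall r, a r \is a Num.int) ->
  interpolation a \in PL_pred N Sigma.
Proof.
move=> aZ; apply/asboolP; split => [v nv|sigma Ss|r].
- rewrite /interpolation; case: xgetP => // y _ [I [l [SI Iv _ _]]].
  by case: nv; exists (span_cone N I).
- have [I SI ->] := fan_span_cone uf Ss; have [l lE] := spans_linear a SI.
  by exists l => v Iv; apply: interpolationE SI Iv lE.
- by rewrite interpolation_prim.
Qed.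

Lemma PL_linear f I : spans_cone N I ->
  exists l : 'Hom(V, rat^o), forall v, span_cone N I v -> f v = l v.
Proof. by case: f => f /= /asboolP[_ fl _] SI; apply: fl. Qed.

Lemma PL_ext f g :
  (forall r, f (prim N (val r)) = g (prim N (val r))) -> f = g.
Proof.
move=> fg; apply: val_inj => /=; apply/funext => v.
have [[sigma Ss sv]|nv] := pselect (Defs.support Sigma v); last first.
  by case: f g {fg} => f /= /asboolP[f0 _ _] [g /= /asboolP[g0 _ _]];
    rewrite f0 // g0.
have [I SI sE] := fan_span_cone uf Ss; rewrite sE in sv.
have [l fl] := PL_linear f SI; have [l' gl] := PL_linear g SI.
rewrite fl // gl //; apply: linear_eq_on_span_cone sv => r rI.
by rewrite -fl ?fg -?gl //; apply: span_cone_prim.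
Qed.

(** Stated in the same form as [courant], which thereby becomes an instance by conversion. It is
    meaningful for integral [a]. *)
Definition mkPL a : PL N Sigma :=
  xget 0 [set x : PL N Sigma | forall r, x (prim N (val r)) = a r].

Lemma mkPLE a r : (forall r, a r \is a Num.int) ->
  mkPL a (prim N (val r)) = a r.
Proof.
move=> aZ; rewrite /mkPL; case: xgetP =>
  [x _ //|/(_ (MkPL (interpolation_PL aZ)))[]] /=.
exact: interpolation_prim.
Qed.

Lemma courantE r r' : courant N r (prim N (val r')) = (r' == r)%:R.
Proof. exact: (@mkPLE (fun r' => (r' == r)%:R)). Qed.

Lemma PL_sum_courant (F : rays Sigma -> int) r :
  (\sum_r' courant N r' *~ F r') (prim N (val r)) = (F r)%:~R.
Proof.
rewrite PL_sum (bigD1 r) //= big1 => [|r' r'r]; rewrite PL_Mz courantE.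
  by rewrite eqxx addr0.
by rewrite eq_sym (negbTE r'r) mul0rz.
Qed.

Lemma PL_of_dualE m r : dual_lattice N m ->
  PL_of_dual N Sigma m (prim N (val r)) = m (prim N (val r)).
Proof.
by move=> mN; rewrite PL_sum_courant floorK //; apply: mN;
  apply: (prim_lattice uf).
Qed.

Lemma PL_decomp f :
  f = \sum_r courant N r *~ Num.floor (f (prim N (val r))).
Proof. by apply: PL_ext => r; rewrite PL_sum_courant floorK // PL_int. Qed.

(** The difference of [g] and [f] is an integral combination of Courant functions of rays in [S].
    The equivalence in the hypothesis allows steps in both directions, hence coefficients of either
    sign. *)
Lemma PL_courant_ind (S : {set rays Sigma}) (P : PL N Sigma -> Prop) :
  (forall r f, r \in S -> P f <-> P (f - courant N r)) ->
  forall f g, (forall r, r \notin S ->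
    f (prim N (val r)) = g (prim N (val r))) ->
  P f -> P g.
Proof.
move=> PS f g fg Pf.
pose k r := Num.floor (g (prim N (val r)) - f (prim N (val r))).
have -> : g = f + \sum_r courant N r *~ k r.
  apply: PL_ext => r; rewrite PL_D PL_sum_courant floorK ?rpredB ?PL_int //.
  by rewrite addrC subrK.
rewrite (bigID (mem S)) /= [X in _ + (_ + X)]big1 ?addr0 => [|r rS]; last first.
  by rewrite /k fg // subrr floor0 mulr0z.
have Pn r h n : r \in S -> P h <-> P (h - courant N r *+ n).
  move=> rS; elim: n h => [|n IH] h; first by rewrite mulr0n subr0.
  by rewrite mulrS opprD addrA -IH; apply: PS.
elim/big_rec: _ => [|r h rS]; first by rewrite addr0.
rewrite addrCA; case: (k r) => n.
  by rewrite (Pn r (_ + (f + h)) n rS) addrAC -pmulrn subrr add0r.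
by rewrite NegzE mulrNz -pmulrn addrC -Pn.
Qed.

Lemma diff_op_courant_int (h : PL N Sigma -> rat) : h 0 \is a Num.int ->
  (forall r f, diff_op (courant N r) h f \is a Num.int) ->
  forall f, h f \is a Num.int.
Proof.
move=> h0 hD f; apply: (@PL_courant_ind finset.setT (fun f =>
  h f \is a Num.int) _ 0) => //.
  move=> r g _; have := hD r g; rewrite /diff_op => rg; split=> hg.
    by rewrite -[h _](subKr (h g)) rpredB.
  by rewrite -(subrK (h (g - courant N r)) (h g)) rpredD.
by move=> r; rewrite inE.
Qed.

End PiecewiseLinear.

(** * Star fans *)

Section Quotient.
Variables (V : vectType rat) (u : V).
Local Notation W := (<[u]>^C)%VS.

(** [quot_map] packaged as a linear map. *)
Definition quot_hom : 'Hom(V, quot_space u) :=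
  (linfun (vsproj W) \o daddv_pi W <[u]>)%VF.

Lemma quot_homE v : quot_map u v = quot_hom v.
Proof. by rewrite comp_lfunE lfunE. Qed.

Let WL : (W :&: <[u]> = 0)%VS.
Proof. by rewrite capvC capv_compl. Qed.

Let decomp v : daddv_pi W <[u]> v + daddv_pi <[u]> W v = v.
Proof. by apply: daddv_pi_add; rewrite // addvC addv_complf memvf. Qed.

Lemma quot_self : quot_hom u = 0.
Proof.
rewrite -quot_homE /quot_map.
have := decomp u; rewrite [X in _ + X]daddv_pi_id ?capv_compl ?memv_line // =>
  /eqP.
by rewrite -subr_eq0 addrK => /eqP->; rewrite linear0.
Qed.

Lemma quot_ker v : quot_hom v = 0 -> exists k, v = k *: u.
Proof.
rewrite -quot_homE /quot_map => v0; apply/vlineP.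
have p0 : daddv_pi W <[u]> v = 0.
  by rewrite -(vsprojK (memv_pi W <[u]> v)) v0 linear0.
by rewrite -(decomp v) p0 add0r memv_pi.
Qed.

Lemma quot_val (w : quot_space u) : quot_hom (vsval w) = w.
Proof. by rewrite -quot_homE /quot_map daddv_pi_id ?subvsP // vsvalK. Qed.

Lemma quot_descend (m : 'Hom(V, rat^o)) : m u = 0 ->
  exists m' : 'Hom(quot_space u, rat^o), forall v, m' (quot_hom v) = m v.
Proof.
move=> mu; exists (m \o linfun vsval)%VF => v; rewrite comp_lfunE lfunE /=.
apply/eqP; rewrite -subr_eq0 -linearB; apply/eqP.
have [|k ->] := @quot_ker (vsval (quot_hom v) - v).
  by rewrite linearB /= quot_val subrr.
by rewrite linearZ /= mu scaler0.
Qed.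

Lemma quot_lattice_basis (N : set V) (b : seq V) : lattice_basis N (u :: b) ->
  lattice_basis (quot_lattice N (u := u)) (map quot_hom b).
Proof.
move=> lb; have [bb _] := lb.
have ub : uniq b by case/andP: (free_uniq (basis_free bb)).
have u0 : u != 0 by apply: (basis_not0 bb); rewrite inE eqxx.
(* The images span because the quotient map is onto and kills [u]; their number is the dimension of
   the quotient. *)
have bb' : basis_of fullv (map quot_hom b).
  rewrite basisEdim; apply/andP; split.
    apply/subvP => w _; rewrite -(quot_val w).
    have : vsval w \in <<u :: b>>%VS by rewrite (span_basis bb) memvf.
    rewrite span_cons => /memv_addP[_ /vlineP[k ->]] [y yb ->].
    rewrite linearD linearZ /= quot_self scaler0 add0r -limg_span.
    exact: memv_img.
  rewrite size_map dimvf /dim /= dimv_compl dim_vline u0.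
  have /= sb := size_basis (bb : basis_of fullv (in_tuple (u :: b))).
  by rewrite sb subn1.
apply: mk_lattice_basis => // w.
(* The images of the entries of [b] are distinct, so integral coefficients can be carried back and
   forth between [b] and its image. *)
have im x0 x : x \in b -> nth x0 b (index (quot_hom x) (map quot_hom b)) = x.
  move=> xb; rewrite -{1}(nth_index x0 xb) -(nth_map x0 (quot_hom x0))
    ?index_mem //.
  by rewrite index_uniq ?size_map ?index_mem ?nth_index
    // (free_uniq (basis_free bb')).
split=> [[v /(lattice_basisP lb)[c ->] <-]|[c ->]].
  exists (fun y => c (nth 0 b (index y (map quot_hom b)))).
  rewrite quot_homE big_cons linearD raddfMz /= quot_self mul0rz add0r.
  rewrite linear_sum big_map; apply: eq_big_seq => x xb /=.
  by rewrite raddfMz im.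
exists (\sum_(x <- b) x *~ c (quot_hom x)).
  apply/(lattice_basisP lb).
  exists (fun x => if x \in b then c (quot_hom x) else 0).
  rewrite big_cons; case: ifP (free_uniq (basis_free bb)) => [ub' /=|_ _].
    by rewrite ub'.
  by rewrite mulr0z add0r; apply: eq_big_seq => x ->.
rewrite quot_homE linear_sum big_map; apply: eq_bigr => x _.
by rewrite raddfMz.
Qed.

End Quotient.

Section Star.
Variables (V : vectType rat) (N : set V) (Sigma : set (set V)).
Hypothesis uf : unimodular_fan N Sigma.
Variable rho : rays Sigma.
Implicit Types (r : rays Sigma) (I : {set rays Sigma}).

Let u := prim N (val rho).
Local Notation pi := (quot_hom (prim N (val rho))).
Local Notation N' := (quot_lattice N (u := prim N (val rho))).
Local Notation Sigma' := (star Sigma (val rho) (u := prim N (val rho))).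

Lemma sub_span_coneP I : spans_cone N I ->
  val rho `<=` span_cone N I <-> rho \in I.
Proof.
move=> SI; split=> [rI|rI]; last first.
  by rewrite (prim_cone uf rho); apply: cone1_sub; apply: span_cone_prim.
apply: (mem_of_span_cone uf SI); apply: rI; exact: (prim_mem uf).
Qed.

Lemma image_span_cone I : rho \in I ->
  quot_map u @` span_cone N I =
  cone [seq pi (prim N (val r)) | r : rays Sigma in I :\ rho].
Proof.
move=> rI; rewrite /image_mem; apply/seteqP; split=> v.
  move=> [w /span_coneP[c [c0 ->]] <-]; apply/cone_mapP; first exact: enum_uniq.
  exists c; split=> //; rewrite big_enum /= quot_homE (big_setD1 rho) //=.
  rewrite linearD linearZ /= quot_self scaler0 add0r linear_sum.
  by apply: eq_bigr => r _; rewrite linearZ.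
move=> /cone_mapP-/(_ (enum_uniq _))[c [c0 ->]].
exists (\sum_(r in I :\ rho) c r *: prim N (val r)).
  apply/span_coneP; exists (fun r => if r == rho then 0 else c r).
  split=> [r|]; first by case: ifP.
  rewrite [RHS](big_setD1 rho) //= eqxx scale0r add0r.
  by apply: eq_bigr => r; rewrite !inE => /andP[/negbTE-> _].
rewrite big_enum /= quot_homE linear_sum.
by apply: eq_bigr => r _; rewrite linearZ.
Qed.

Lemma star_coneP sigma' : Sigma' sigma' <-> exists I,
  [/\ spans_cone N I, rho \in I & sigma' = quot_map u @` span_cone N I].
Proof.
split=> [[sigma [Ss rs] <-]|[I [SI rI ->]]].
  have [I SI sE] := fan_span_cone uf Ss; rewrite sE in rs *.
  by exists I; split=> //; apply/sub_span_coneP.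
by exists (span_cone N I) => //; split=> //; apply/sub_span_coneP.
Qed.

Lemma star_basis I : spans_cone N I -> rho \in I ->
  exists t, lattice_basis N'
    ([seq pi (prim N (val r)) | r : rays Sigma in I :\ rho] ++ t).
Proof.
move=> SI rI; have [t lb] := spans_basis uf SI; exists (map pi t).
rewrite /image_mem (map_comp pi (fun r => prim N (val r))) -map_cat.
apply: quot_lattice_basis; apply: lattice_basis_perm lb.
rewrite -[_ :: _]/((_ :: _) ++ _) perm_cat2r
  -[_ :: _]/(map (fun r => prim N (val r)) (rho :: _)).
apply: perm_map; apply: uniq_perm; rewrite /= ?enum_uniq ?mem_enum ?inE ?eqxx
  //.
by move=> r; rewrite inE !mem_enum !inE; case: eqP => // ->.
Qed.

Lemma star_unimodular : unimodular_fan N' Sigma'.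
Proof.
split.
- apply: finite_image; apply: sub_finite_set (fan_finite uf) => s [] //.
- by exists (quot_map u @` val rho), (val rho) => //; split=> //;
  apply: (ray_Sigma uf).
- move=> _ /star_coneP[I [SI rI ->]]; have [t lb] := star_basis SI rI.
  exists [seq pi (prim N (val r)) | r : rays Sigma in I :\ rho], t; split=> //.
  exact: image_span_cone.
- move=> _ tau' [sigma [Ss rs] <-] [m' [m'0 ->]].
  have mu v : (m' \o pi)%VF v = m' (quot_map u v) by rewrite comp_lfunE
    quot_homE.
  (* The functional pulled back from the quotient kills [u], so the face that it cuts out of [sigma]
     still contains [rho]. *)
  exists [set v | sigma v /\ (m' \o pi)%VF v = 0].
    split.
      apply: (fan_face uf Ss); exists (m' \o pi)%VF; split=> // v sv.
      by rewrite mu; apply: m'0; exists v.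
    move=> v rv; split; first exact: rs.
    have [k _ ->] := (ray_memP uf rho v).1 rv.
    by rewrite comp_lfunE linearZ /= quot_self scaler0 linear0.
  apply/seteqP; split=> [_ [v [sv mv] <-]|_ [[v sv <-] mv]].
    by rewrite mu in mv; split=> //; exists v.
  by exists v => //; split=> //; rewrite mu.
have inter sigma tau : Sigma sigma -> Sigma tau -> val rho `<=` sigma ->
    val rho `<=` tau -> face (quot_map u @` sigma `&` quot_map u @` tau)
      (quot_map u @` sigma).
  move=> Ss St rs rt.
  have close sig a k : Sigma sig -> val rho `<=` sig -> sig a -> 0 <= k ->
    sig (a + k *: u).
    move=> Ssig rsig siga k0; have [s [t [_ sE]]] := fan_unimodular uf Ssig.
    have sigu : sig u by apply: rsig; apply: (prim_mem uf).
    rewrite sE in siga sigu *; rewrite -[a]scale1r.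
    exact: cone_closed_comb.
  (* Lifts [a] in [sigma] and [b] in [tau] of a common point satisfy [b = a + k *: u]. Both cones
     are closed under adding nonnegative multiples of [u], so [b] lies in [sigma] if [k] is
     nonnegative, and [a] lies in [tau] otherwise. *)
  have -> : quot_map u @` sigma `&` quot_map u @` tau =
      quot_map u @` (sigma `&` tau).
    apply/seteqP; split=> [_ [[a sa <-] [b tb]]|_ [v [sv tv] <-]]; last first.
      by split; exists v.
    rewrite !quot_homE => /eqP; rewrite -subr_eq0 -linearB => /eqP/quot_ker[k].
    move=> /eqP; rewrite subr_eq addrC => /eqP bE.
    have [k0|k0] := leP 0 k.
      exists b; last by rewrite quot_homE bE linearD linearZ /= quot_self
        scaler0 addr0.
      by split=> //; rewrite bE; apply: close.
    exists a; last by rewrite quot_homE.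
    split=> //; have -> : a = b + (- k) *: u by rewrite bE scaleNr addrK.
    by apply: close => //; rewrite oppr_ge0 ltW.
  have [[m [m0 mE]] _] := fan_inter uf Ss St.
  (* Both cones contain [u], so the functional defining their common face vanishes at [u] and
     descends. *)
  have mu : m u = 0.
    have : (sigma `&` tau) u.
      by split; [apply: rs|apply: rt]; apply: (prim_mem uf).
    by rewrite mE => -[].
  have [m' m'E] := quot_descend mu; exists m'; split=> [_ [v sv <-]|].
    by rewrite quot_homE m'E; apply: m0.
  apply/seteqP; split=> [_ [v stv <-]|_ [[v sv <-] mv]].
    move: stv; rewrite mE => -[sv mv].
    by split; [exists v|rewrite quot_homE m'E].
  by rewrite quot_homE m'E in mv; exists v; rewrite ?mE.
move=> _ _ [sigma [Ss rs] <-] [tau [St rt] <-]; split; first exact: inter.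
by rewrite setIC; apply: inter.
Qed.

Let uf' := star_unimodular.
Implicit Types (q : rays Sigma') (J : {set rays Sigma'}).

(** The functional dual to [r] in the cone of the pair is 1 at its generator and 0 at that of [rho],
    so the first is no multiple of the second. *)
Lemma quot_prim_neq0 r : r != rho -> spans_cone N [set rho; r]%SET ->
  pi (prim N (val r)) != 0.
Proof.
move=> rr Sr; apply/eqP => /quot_ker[k rE].
have [m [_ mE]] := spans_dual uf Sr.
have := mE r r; rewrite {1}rE functionalZ !mE ?inE ?eqxx ?orbT //.
by rewrite eq_sym (negbTE rr) mulr0 => /(_ isT isT)/eqP;
  rewrite eq_sym oner_eq0.
Qed.

Lemma spans_pair I r : spans_cone N I -> rho \in I -> r \in I ->
  spans_cone N [set rho; r]%SET.
Proof.
move=> SI rhoI rI; apply: (spans_sub uf _ SI).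
by apply/fintype.subsetP => x; rewrite !inE => /orP[]/eqP->.
Qed.

Lemma star_prim r q : r != rho -> spans_cone N [set rho; r]%SET ->
  val q = cone [:: pi (prim N (val r))] ->
  prim N' (val q) = pi (prim N (val r)).
Proof.
move=> rr Sr qE; apply: (primE uf'); first exact: quot_prim_neq0.
have [|t lb] := star_basis Sr; first by rewrite !inE eqxx.
rewrite qE; apply: (primitive_of_basis lb); rewrite mem_cat; apply/orP; left.
by apply/fintype.imageP; exists r => //; rewrite !inE rr eqxx orbT.
Qed.

Lemma ray_of_star q : exists r, [/\ r != rho, spans_cone N [set rho; r]%SET
  & prim N' (val q) = pi (prim N (val r))].
Proof.
have /star_coneP[I [SI rI qE]] := ray_Sigma uf' q.
have qE' : val q = cone [seq pi (prim N (val r)) | r : rays Sigma in I :\ rho].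
  by rewrite qE image_span_cone.
(* If [rho] were the only ray of [I], the image cone would be the origin. *)
have [r rIr] : exists r, r \in I :\ rho.
  have [I0|//] := set_0Vmem (I :\ rho); last by move=> [r rI']; exists r.
  have := prim_neq0 uf' q; have := prim_mem uf' q.
  by rewrite {1}qE' I0 /image_mem enum_set0 cone_nilE /= => ->; rewrite eqxx.
have /setD1P[rr rI'] := rIr; have Sr := spans_pair SI rI rI'.
exists r; split=> //; apply: star_prim => //.
rewrite (prim_cone uf' q); apply: cone1_eq; first exact: quot_prim_neq0.
rewrite -(prim_cone uf' q) qE'; apply: cone_mem.
by apply/fintype.imageP; exists r.
Qed.

(** Identifies the rays of the star with the link of [rho], the rays that span a cone together with
    [rho]. The default [rho] is not in that set and never occurs. *)
Definition down q : rays Sigma :=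
  xget rho [set r | [/\ r != rho, spans_cone N [set rho; r]%SET
    & prim N' (val q) = pi (prim N (val r))]].

Lemma downP q : [/\ down q != rho, spans_cone N [set rho; down q]%SET
    & prim N' (val q) = pi (prim N (val (down q)))].
Proof.
rewrite /down; case: xgetP => [r //|nex].
by have [r rP] := ray_of_star q; case: (nex r).
Qed.

Lemma down_neq q : down q != rho.
Proof. by have [] := downP q. Qed.

Lemma down_spans q : spans_cone N [set rho; down q]%SET.
Proof. by have [] := downP q. Qed.

Lemma prim_down q : prim N' (val q) = pi (prim N (val (down q))).
Proof. by have [] := downP q. Qed.

Lemma down_inj : injective down.
Proof. by move=> r1 r2 e; apply: (prim_inj uf'); rewrite !prim_down e. Qed.

Lemma down_onto r : r != rho -> spans_cone N [set rho; r]%SET ->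
  exists q, down q = r.
Proof.
move=> rr Sr.
have rhoI : rho \in [set rho; r]%SET by rewrite !inE eqxx.
have Ir : [set rho; r]%SET :\ rho = [set r]%SET.
  by apply/setP => x; rewrite !inE; case: eqP => //= ->;
    rewrite eq_sym (negbTE rr).
have Sc : Sigma' (cone [:: pi (prim N (val r))]).
  apply/star_coneP; exists [set rho; r]%SET; split=> //.
  by rewrite image_span_cone // Ir /image_mem enum_set1.
have [q qE] := ray_intro uf' Sc (quot_prim_neq0 rr Sr) erefl.
exists q; have := star_prim rr Sr qE; rewrite prim_down => /eqP.
rewrite -subr_eq0 -linearB => /eqP/quot_ker[k] /eqP; rewrite subr_eq => /eqP kE.
(* The generators of [down q] and [r] differ by [k *: u]. According to the sign of [k], one of them
   lies in the cone spanned by [rho] and the other, and so is one of its two rays. *)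
have [k0|k0] := leP 0 k.
  have : down q \in [set rho; r]%SET.
    apply: (mem_of_span_cone uf Sr); rewrite kE -[X in _ + X]scale1r.
    by apply: cone_closed_comb => //; apply: span_cone_prim;
      rewrite !inE eqxx ?orbT.
  by rewrite !inE (negbTE (down_neq q)) => /eqP.
have : r \in [set rho; down q]%SET.
  apply: (mem_of_span_cone uf (down_spans q)).
  have -> : prim N (val r) = (- k) *: u + 1 *: prim N (val (down q)).
    by rewrite kE scale1r scaleNr addKr.
  apply: cone_closed_comb; rewrite ?oppr_ge0 ?(ltW k0) //;
    by apply: span_cone_prim; rewrite !inE eqxx ?orbT.
by rewrite !inE (negbTE rr) => /eqP.
Qed.

Lemma rho_notin_down J : rho \notin down @: J.
Proof. by apply/imsetP => -[q _ e]; move: (down_neq q); rewrite -e eqxx. Qed.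

Lemma span_cone_down J : quot_map u @` span_cone N (rho |: down @: J)%SET =
  span_cone N' J.
Proof.
rewrite image_span_cone ?setU11 // setU1K ?rho_notin_down // /span_cone
  /image_mem.
apply/esym/cone_perm.
  by rewrite map_inj_in_uniq ?enum_uniq // => q1 q2 _ _; apply: (prim_inj uf').
rewrite (eq_map prim_down) (map_comp (fun r => pi (prim N (val r)))) perm_map //.
apply: uniq_perm; rewrite ?enum_uniq ?(map_inj_uniq down_inj) ?enum_uniq // => r.
rewrite mem_enum; apply/mapP/imsetP => -[q qJ ->]; exists q => //.
  by rewrite mem_enum in qJ.
by rewrite mem_enum.
Qed.

(** A cone of the star is the image of the cone of some [I] containing [rho]. All other rays of [I]
    are in the link, so [I] comes from a set [J2] of rays of the star, and [J2] equals [J] since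
    both span the same cone. *)
Lemma spans_star J : spans_cone N' J <-> spans_cone N (rho |: down @: J)%SET.
Proof.
split=> [SJ|SI]; last first.
  rewrite /spans_cone -/(span_cone N' J) -span_cone_down; apply/star_coneP.
  by exists (rho |: down @: J)%SET; rewrite setU11.
have /star_coneP[I [SI rI]] := SJ; rewrite -/(span_cone N' J).
pose J2 : {set rays Sigma'} := [set q | down q \in I]%SET.
have IE : I = (rho |: down @: J2)%SET.
  apply/setP => r; rewrite !inE; case: eqP => [->//|/eqP rr] /=.
  apply/idP/imsetP => [rI'|[q + ->]]; last by rewrite inE.
  have [q qE] := down_onto rr (spans_pair SI rI rI').
  by exists q; rewrite ?inE qE.
rewrite IE span_cone_down => JE.
have SJ2 : spans_cone N' J2 by rewrite /spans_cone -/(span_cone N' J2) -JE.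
by rewrite (span_cone_inj uf' SJ SJ2 JE) -IE.
Qed.

(** On a cone containing [rho], both [f - m] and the pullback of [g] are linear, so comparing them
    at the generators suffices. At [rho] both vanish; the other rays of the cone are in the link. *)
Lemma star_classP (f : PL N Sigma) (g : star_PL N rho) : star_class f g <->
  exists m, [/\ dual_lattice N m, m (prim N (val rho)) = f (prim N (val rho))
    & forall q, g (prim N' (val q)) =
        f (prim N (val (down q))) - m (prim N (val (down q)))].
Proof.
split=> -[m [mN mf mg]]; exists m; split=> //.
  move=> q; have Sr := down_spans q; rewrite prim_down -quot_homE;
    apply: (mg _ Sr).
    by apply/(sub_span_coneP Sr); rewrite !inE eqxx.
  by apply: span_cone_prim; rewrite !inE eqxx orbT.
move=> sigma Ss rs v sv.
have [I SI sE] := fan_span_cone uf Ss; rewrite sE in rs sv.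
have rI : rho \in I by apply/sub_span_coneP.
have S' : Sigma' (quot_map u @` span_cone N I) by apply/star_coneP; exists I.
have [l fl] := PL_linear f SI.
have [l' gl] : exists l' : 'Hom(quot_space u, rat^o),
    forall w, (quot_map u @` span_cone N I) w -> g w = l' w.
  by case: (g) => g' /= /asboolP[_ gl _]; apply: gl.
rewrite fl // gl; last by exists v.
rewrite quot_homE.
have -> : l' (pi v) = (l' \o pi)%VF v by rewrite comp_lfunE.
have -> : l v - m v = (l - m) v by rewrite add_lfunE opp_lfunE.
apply: linear_eq_on_span_cone sv => r rI'.
rewrite comp_lfunE add_lfunE opp_lfunE -fl; last exact: span_cone_prim.
have [->|rr] := eqVneq r rho; first by rewrite quot_self linear0 mf subrr.
have [q qE] := down_onto rr (spans_pair SI rI rI').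
rewrite -qE -mg -prim_down gl // prim_down; exists (prim N (val r)).
  exact: span_cone_prim.
by rewrite quot_homE qE.
Qed.

Lemma card_rays_star : (#|{: rays Sigma'}| < #|{: rays Sigma}|)%N.
Proof.
rewrite -cardsT -(card_imset _ down_inj) -[X in (_ < X)%N]cardsT.
apply: proper_card; apply/properP; split; first exact: finset.subsetT.
by exists rho; rewrite ?inE // rho_notin_down.
Qed.

End Star.

(** * Polynomial functions and their differences *)

Section PolynomialFunctions.
Import -(notations) mpoly.
Variables (A : Type) (n : nat) (ev : 'I_n -> A -> rat).

(** [polynomial_function] for an arbitrary system of coordinates, so that a fan and its stars are
    treated alike. *)
Definition polyfun (h : A -> rat) : Prop :=
  exists p : mpoly.mpoly n rat, forall a, h a = mpoly.meval (ev ^~ a) p.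

Lemma polyfun_ext h h' : h =1 h' -> polyfun h -> polyfun h'.
Proof. by move=> hh' [p hp]; exists p => a; rewrite -hh'. Qed.

Lemma polyfun_const c : polyfun (fun=> c).
Proof. by exists (mpoly.mpolyC n c) => a; rewrite mpoly.mevalC. Qed.

Lemma polyfun_ev i : polyfun (ev i).
Proof. by exists (mpoly.mpolyX rat (mpoly.mnm1 i)) => a;
  rewrite mpoly.mevalXU. Qed.

Lemma polyfunD h h' : polyfun h -> polyfun h' -> polyfun (fun a => h a + h' a).
Proof. by move=> [p hp] [q hq]; exists (p + q) => a;
  rewrite mpoly.mevalD hp hq. Qed.

Lemma polyfunM h h' : polyfun h -> polyfun h' -> polyfun (fun a => h a * h' a).
Proof. by move=> [p hp] [q hq]; exists (p * q) => a;
  rewrite mpoly.mevalM hp hq. Qed.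

Lemma polyfunN h : polyfun h -> polyfun (fun a => - h a).
Proof. by move=> [p hp]; exists (- p) => a; rewrite mpoly.mevalN hp. Qed.

Lemma polyfun_sum (T : Type) (s : seq T) (P : pred T) (h : T -> A -> rat) :
  (forall i, polyfun (h i)) -> polyfun (fun a => \sum_(i <- s | P i) h i a).
Proof.
move=> hP; elim: s => [|i s IH].
  by apply: polyfun_ext (polyfun_const 0) => a; rewrite big_nil.
have [Pi|Pi] := boolP (P i).
  by apply: polyfun_ext (polyfunD (hP i) IH) => a; rewrite big_cons Pi.
by apply: polyfun_ext IH => a; rewrite big_cons (negbTE Pi).
Qed.

Lemma polyfunX h k : polyfun h -> polyfun (fun a => h a ^+ k).
Proof.
move=> hP; elim: k => [|k IH]; first exact: polyfun_const.
by apply: polyfun_ext (polyfunM hP IH) => a; rewrite exprS.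
Qed.

Lemma polyfun_prod (T : Type) (s : seq T) (P : pred T) (h : T -> A -> rat) :
  (forall i, polyfun (h i)) -> polyfun (fun a => \prod_(i <- s | P i) h i a).
Proof.
move=> hP; elim: s => [|i s IH].
  by apply: polyfun_ext (polyfun_const 1) => a; rewrite big_nil.
have [Pi|Pi] := boolP (P i).
  by apply: polyfun_ext (polyfunM (hP i) IH) => a; rewrite big_cons Pi.
by apply: polyfun_ext IH => a; rewrite big_cons (negbTE Pi).
Qed.

Lemma polyfun_horner (p : {poly rat}) h : polyfun h ->
  polyfun (fun a => p.[h a]).
Proof.
move=> hP; apply: (@polyfun_ext (fun a => \sum_(i < size p) p`_i * h a ^+ i)).
  by move=> a; rewrite horner_coef.
by apply: polyfun_sum => i; apply: polyfunM;
  [exact: polyfun_const|exact: polyfunX].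
Qed.

End PolynomialFunctions.

Section PolynomialComposition.
Import -(notations) mpoly.

Lemma polyfun_comp (A B : Type) (n k : nat) (ev : 'I_n -> A -> rat)
    (ev' : 'I_k -> B -> rat) (g : A -> B) (h : B -> rat) :
  (forall j, polyfun ev (fun a => ev' j (g a))) -> polyfun ev' h ->
  polyfun ev (fun a => h (g a)).
Proof.
move=> gP [p hp].
apply: (@polyfun_ext _ _ _ (fun a => \sum_(m <- mpoly.msupp p)
    mpoly.mcoeff m p * \prod_(i < k) ev' i (g a) ^+ m i)).
  by move=> a; rewrite hp mpoly.mevalE.
apply: polyfun_sum => m; apply: polyfunM; first exact: polyfun_const.
by apply: polyfun_prod => i; apply: polyfunX.
Qed.

End PolynomialComposition.

(** * Antidifferences of polynomials *)

Lemma poly_antidifference (m : nat) (d : nat -> rat) : exists G : {poly rat},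
  forall x, G.[x] - G.[x - 1] = \sum_(j < m) d j * x ^+ j.
Proof.
elim: m d => [|m IH] d; first by exists 0 => x; rewrite !horner0 subr0 big_ord0.
(* The difference of [c *: 'X^(m.+1)] has leading term [d m * x ^+ m]. The numbers [b j] are the
   binomial coefficients of [(x - 1) ^+ m.+1]; the lower terms that they contribute are compensated
   through the induction hypothesis. *)
pose b (j : nat) : rat := (-1) ^+ (m.+1 - j) *+ 'C(m.+1, j).
pose c := d m / m.+1%:R.
have [G GE] := IH (fun j => d j + c * b j).
exists (G + c *: 'X^(m.+1)) => x; rewrite !hornerE.
have -> : (x - 1) ^+ m.+1 = x ^+ m.+1 - m.+1%:R * x ^+ m +
  \sum_(j < m) b j * x ^+ j.
  rewrite addrC exprDn 2!big_ord_recr /= subnn expr0 mul1r binn mulr1n.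
  rewrite subSnn expr1 mulN1r mulNrn -mulr_natl binSn addrC.
  rewrite mulr1 mulr_natl addrA addrAC; congr (_ + _); apply: eq_bigr => j _.
  by rewrite /b -!mulrnAl.
have dE : d m = c * m.+1%:R by rewrite /c divfK // pnatr_eq0.
have GE' : G.[x] - G.[x - 1] =
    \sum_(j < m) d j * x ^+ j + c * \sum_(j < m) b j * x ^+ j.
  rewrite GE mulr_sumr -big_split; apply: eq_bigr => j _.
  by rewrite mulrDl mulrA.
rewrite big_ord_recr /= dE -(addrK (c * \sum_(j < m) b j * x ^+ j)
  (\sum_(j < m) d j * _)) -GE'.
rewrite !mulrDr !mulrN mulrA !opprD !opprK.
by rewrite addrACA -[X in _ + (_ + X)]addrA addNKr addrA addrAC.
Qed.

Section Antidifference.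
Import -(notations) mpoly.
Variables (A : zmodType) (n : nat) (ev : 'I_n -> A -> rat).

(** In each monomial the power of the coordinate [i0] is replaced by a one-variable antidifference;
    the other coordinates are unchanged by the shift. *)
Lemma polyfun_antidifference (e : A) (i0 : 'I_n) h :
  (forall i a, ev i (a - e) = ev i a - (i == i0)%:R) -> polyfun ev h ->
  exists2 r, polyfun ev r & forall a, r a - r (a - e) = h a.
Proof.
move=> evB [p hp].
have xpow k : exists G : {poly rat}, forall x, G.[x] - G.[x - 1] = x ^+ k.
  have [G GE] := poly_antidifference k.+1 (fun j => (j == k)%:R).
  exists G => x; rewrite GE big_ord_recr /= eqxx mul1r big1 ?add0r // => j _.
  by rewrite ltn_eqF ?mul0r.
have [G GE] := choice xpow.
exists (fun a => \sum_(m <- mpoly.msupp p) mpoly.mcoeff m p *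
    ((G (m i0)).[ev i0 a] * \prod_(i < n | i != i0) ev i a ^+ m i)).
  apply: polyfun_sum => m; apply: polyfunM; first exact: polyfun_const.
  apply: polyfunM; first by apply: polyfun_horner; exact: polyfun_ev.
  by apply: polyfun_prod => i; apply: polyfunX; exact: polyfun_ev.
move=> a; rewrite hp mpoly.mevalE -sumrB; apply: eq_bigr => m _.
rewrite [X in _ - _ * (_ * X)](eq_bigr (fun i => ev i a ^+ m i)) =>
  [|i /negbTE i0i].
  by rewrite -mulrBr -mulrBl evB eqxx GE [X in _ = _ * X](bigD1 i0).
by rewrite evB i0i subr0.
Qed.

Variable e : 'I_n -> A.
Hypothesis ev_int : forall i a, ev i a \is a Num.int.
Hypothesis evD : forall i a b, ev i (a + b) = ev i a + ev i b.
Hypothesis ev_e : forall i j, ev i (e j) = (i == j)%:R.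
Hypothesis evP : forall a, a = \sum_i e i *~ Num.floor (ev i a).

(* Switching on the coordinates of a point one at a time changes h by the same
   amount as an antidifference of its difference in that direction. *)
Lemma polyfun_of_diff h : (forall i, polyfun ev (diff_op (e i) h)) ->
  polyfun ev h.
Proof.
move=> hD.
have evMz i a k : ev i (a *~ k) = ev i a *~ k.
  have ev0 : ev i 0 = 0 by apply: (addrI (ev i 0)); rewrite -evD !addr0.
  have evN b : ev i (- b) = - ev i b.
    by apply/eqP; rewrite -addr_eq0 -evD addNr ev0.
  have evMn m : ev i (a *+ m) = ev i a *+ m.
    by elim: m => // m IH; rewrite !mulrS evD IH.
  by case: k => m; rewrite ?NegzE ?mulrNz -?pmulrn ?evN evMn.
have evB i a b : ev i (a - b) = ev i a - ev i b.
  by rewrite -(mulrN1z b) evD evMz mulrN1z.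
pose pr (s : seq 'I_n) a := \sum_(i <- s) e i *~ Num.floor (ev i a).
have evpr i s : polyfun ev (fun a => ev i (pr s a)).
  elim: s => [|j s IH].
    apply: polyfun_ext (polyfun_const _ (ev i 0)) => a; rewrite /pr big_nil //.
  apply: polyfun_ext (polyfunD (polyfunM (polyfun_const _ (i == j)%:R)
    (polyfun_ev ev j)) IH).
  move=> a; rewrite /pr big_cons evD evMz ev_e; congr (_ + _).
  by rewrite -mulrzr floorK.
suff hpr s : polyfun ev (fun a => h (pr s a)).
  by apply: polyfun_ext (hpr (index_enum _)) => a; rewrite /pr -evP.
elim: s => [|j s IH].
  by apply: polyfun_ext (polyfun_const _ (h 0)) => a; rewrite /pr big_nil.
have [|r rP rE] := @polyfun_antidifference (e j) j _ _ (hD j).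
  by move=> i a; rewrite evB ev_e.
(* As [h] and [r] have the same difference along [e j], their difference is invariant under integral
   multiples of [e j]. *)
have inv k a : h (a + e j *~ k) - r (a + e j *~ k) = h a - r a.
  have inv1 b : h (b - e j) - r (b - e j) = h b - r b.
    have := rE b; rewrite /diff_op => E.
    by rewrite -(subKr (r b) (r (b - e j))) E opprB opprD opprB addrCA [_ +
      (h b - _)]addrC subrK addrC.
  have invn m b : h (b - e j *+ m) - r (b - e j *+ m) = h b - r b.
    elim: m b => [|m IHm] b; first by rewrite mulr0n subr0.
    by rewrite mulrS opprD addrA IHm inv1.
  case: k => m; last by rewrite NegzE mulrNz -pmulrn invn.
  by rewrite -(invn m (a + _)) -pmulrn addrK.
have rpr t : polyfun ev (fun a => r (pr t a)) by apply: polyfun_comp rP.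
apply: polyfun_ext (polyfunD (polyfunD IH (polyfunN (rpr s))) (rpr (j :: s))) => a.
by rewrite -(inv (Num.floor (ev j a))) /pr big_cons [e j *~ _ + _]addrC subrK.
Qed.

End Antidifference.

(** * Difference operators and stars *)

Section IteratedDifferences.
Variables (A W : zmodType).
Implicit Types (s t : seq A) (h : A -> W).

(** The product of difference operators over a sequence, for which independence of the order is a
    statement about permutations. *)
Definition diff_ops s h : A -> W := foldr (fun v g => diff_op v g) h s.

Lemma diff_opC v w h : diff_op v (diff_op w h) = diff_op w (diff_op v h).
Proof.
by apply/funext => a; rewrite /diff_op (addrAC a (- v)) !opprD addrACA.
Qed.

Lemma diff_ops_diff v s h : diff_ops s (diff_op v h) = diff_op v (diff_ops s h).
Proof. by elim: s => //= w s ->; rewrite diff_opC. Qed.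

Lemma diff_ops_perm s t h : perm_eq s t -> diff_ops s h = diff_ops t h.
Proof.
have rem_ops v r : v \in r -> diff_ops r h = diff_op v (diff_ops (rem v r) h).
  elim: r => //= w r IH; rewrite inE eq_sym; have [->//|wv /= vr] := eqVneq w v.
  by rewrite IH // diff_opC.
elim: s t => [|v s IH] t st; first by move: st => /perm_size/esym/size0nil->.
have vt : v \in t by rewrite -(perm_mem st) inE eqxx.
rewrite (rem_ops _ _ vt) /= (IH (rem v t)) //.
by rewrite -(perm_cons v) (perm_trans st) // perm_to_rem.
Qed.

(** The operator for [v] can be applied first, where it already gives zero. *)
Lemma diff_ops_invariant v s h : v \in s -> (forall a, h (a - v) = h a) ->
  forall a, diff_ops s h a = 0.
Proof.
move=> vs hv a; rewrite (diff_ops_perm h (perm_to_rem vs)) /= -diff_ops_diff.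
have -> : diff_op v h = fun=> 0 by apply/funext => b; rewrite /diff_op hv subrr.
by elim: (rem v s) a => //= w r IH a; rewrite /diff_op !IH subrr.
Qed.

End IteratedDifferences.

Lemma diff_ops_comp (A B W : zmodType) (L : A -> B) (s : seq A) (h : B -> W) a :
  {morph L : x y / x - y} ->
  diff_ops s (fun x => h (L x)) a = diff_ops (map L s) h (L a).
Proof. by move=> LB; elim: s a => //= v s IH a; rewrite /diff_op !IH LB. Qed.

Section CourantDiff.
Variables (V : vectType rat) (N : set V) (Sigma : set (set V)).
Implicit Types (r : rays Sigma) (I : {set rays Sigma}) (h : PL N Sigma -> rat).

Lemma courant_diffE I h :
  courant_diff I h = diff_ops [seq courant N r | r <- enum I] h.
Proof.
rewrite /courant_diff -big_filter.
have -> : [seq r <- index_enum _ | r \in I] = enum I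
  by rewrite [index_enum _]unlock.
by elim: (enum _) => [|r s IH]; rewrite ?big_nil ?big_cons //= IH.
Qed.

(** Puts the difference along [r] innermost, where it can be replaced by the pullback of a function
    on the star. *)
Lemma courant_diffU1 r I h : r \notin I ->
  courant_diff (r |: I)%SET h =
  diff_ops [seq courant N r | r <- enum I] (diff_op (courant N r) h).
Proof.
move=> rI; rewrite courant_diffE diff_ops_diff -[RHS]/(diff_ops (_ :: _) h).
rewrite -(map_cons (fun r => courant N r)); apply/diff_ops_perm/perm_map.
apply: uniq_perm; rewrite /= ?mem_enum ?rI ?enum_uniq // => x.
by rewrite inE !mem_enum !inE.
Qed.

Definition difference_equations h : Prop :=
  [/\ forall m, dual_lattice N m ->
        forall f, diff_op (PL_of_dual N Sigma m) h f = 0,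
      forall I : {set rays Sigma}, ~ spans_cone N I ->
        forall f, courant_diff I h f = 0
    & forall I : {set rays Sigma}, spans_cone N I -> courant_diff I h 0 = 1].

End CourantDiff.

(** * Restriction of piecewise linear functions to a star *)

Section StarRestriction.
Variables (V : vectType rat) (N : set V) (Sigma : set (set V)).
Hypothesis uf : unimodular_fan N Sigma.
Variable rho : rays Sigma.

Local Notation N' := (quot_lattice N (u := prim N (val rho))).
Local Notation Sigma' := (star Sigma (val rho) (u := prim N (val rho))).
Local Notation down := (@down V N Sigma rho).
Let uf' := star_unimodular uf rho.

Lemma exists_dual_one : exists m, dual_lattice N m /\ m (prim N (val rho)) = 1.
Proof.
have [m [mN mE]] := spans_dual uf (spans1 uf rho).
by exists (m rho); split=> //; rewrite mE ?inE // eqxx.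
Qed.

Definition dual_one : 'Hom(V, rat^o) :=
  xget 0 [set m | dual_lattice N m /\ m (prim N (val rho)) = 1].

Lemma dual_oneP : dual_lattice N dual_one /\ dual_one (prim N (val rho)) = 1.
Proof.
by rewrite /dual_one; case: xgetP => [m _ //|nex];
  have [m /nex] := exists_dual_one.
Qed.

(** A representative of the class of [f] on the star. Using multiples of one fixed functional
    [dual_one] makes the choice additive in [f], as needed to commute it with differences. *)
Definition star_restr (f : PL N Sigma) : star_PL N rho :=
  mkPL N' (fun q => f (prim N (val (down q)))
                 - f (prim N (val rho)) *
                   (dual_one (prim N (val (down q))) : rat)).

Lemma star_restrE f (q : rays Sigma') : star_restr f (prim N' (val q)) =
  f (prim N (val (down q))) - f (prim N (val rho)) *
    (dual_one (prim N (val (down q))) : rat).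
Proof.
rewrite (mkPLE uf') // => q'; rewrite rpredB ?rpredM ?PL_int //.
by apply: dual_oneP.1; apply: (prim_lattice uf).
Qed.

Lemma star_restrB : {morph star_restr : f g / f - g}.
Proof.
move=> f g; apply: (PL_ext uf') => q.
by rewrite PL_B !star_restrE !PL_B mulrBl !opprB addrACA [RHS]addrACA [- _ +
  _ in RHS]addrC.
Qed.

Lemma star_restr0 : star_restr 0 = 0.
Proof. by have := star_restrB 0 0; rewrite !subrr. Qed.

Lemma star_class_restr f : star_class f (star_restr f).
Proof.
have [oN o1] := dual_oneP.
apply/(star_classP uf); exists (f (prim N (val rho)) *: dual_one);
  split=> [v Nv||q].
- by rewrite scale_lfunE; apply: rpredM; [exact: PL_int|exact: oN].
- by rewrite scale_lfunE o1 [LHS]mulr1.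
- by rewrite star_restrE scale_lfunE.
Qed.

Lemma star_restr_down (q : rays Sigma') :
  star_restr (courant N (down q)) = courant N' q.
Proof.
apply: (PL_ext uf') => q'; rewrite star_restrE !(courantE uf) (courantE uf').
by rewrite (inj_eq (down_inj uf (rho := rho))) eq_sym [rho == _]eq_sym
  (negbTE (down_neq uf q)) mul0r subr0 eq_sym.
Qed.

Lemma star_restr_nonlink r : r != rho -> ~ spans_cone N [set rho; r]%SET ->
  star_restr (courant N r) = 0.
Proof.
move=> rr Sr; apply: (PL_ext uf') => q; rewrite star_restrE !(courantE uf).
rewrite [rho == _]eq_sym (negbTE rr) mul0r subr0; case: eqP => // e.
by case: Sr; rewrite -e; apply: (down_spans uf).
Qed.

Section Transfer.
Variables (h : PL N Sigma -> rat) (h' : star_PL N rho -> rat).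
Hypothesis hh' : forall f, diff_op (courant N rho) h f = h' (star_restr f).

Lemma diff_ops_star s f :
  diff_ops s (diff_op (courant N rho) h) f = diff_ops (map star_restr s) h'
    (star_restr f).
Proof.
have -> : diff_op (courant N rho) h = fun f =>
  h' (star_restr f) by apply/funext.
by apply: diff_ops_comp; exact: star_restrB.
Qed.

(** Restriction is additive and sends the Courant function of [down q] to that of [q], so
    differences of the pullback along the link are pullbacks of differences on the star. *)
Lemma courant_diff_star (J : {set rays Sigma'}) f :
  courant_diff (rho |: down @: J)%SET h f = courant_diff J h' (star_restr f).
Proof.
rewrite courant_diffU1 ?(rho_notin_down uf) // diff_ops_star courant_diffE.
have /diff_ops_perm-> // : perm_eq (map star_restr
  [seq courant N r | r <- enum (down @: J)%SET])
    [seq courant N' q | q <- enum J].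
have -> : [seq courant N' q | q <- enum J] =
    map star_restr [seq courant N r | r <- map down (enum J)].
  by rewrite -!map_comp; apply: eq_map => q; rewrite /= star_restr_down.
do 2!apply: perm_map; apply: uniq_perm;
  rewrite ?enum_uniq ?(map_inj_uniq (down_inj uf (rho := rho))) ?enum_uniq // => r.
rewrite mem_enum; apply/imsetP/mapP => -[q qJ ->]; exists q => //.
  by rewrite mem_enum.
by rewrite mem_enum in qJ.
Qed.

(** The Courant function of [r] restricts to 0 on the star, so the pullback is invariant under
    it. *)
Lemma courant_diff_nonlink (I : {set rays Sigma}) r f : rho \in I -> r \in I ->
  r != rho ->
  ~ spans_cone N [set rho; r]%SET -> courant_diff I h f = 0.
Proof.
move=> rhoI rI rr Sr; rewrite -(finset.setD1K rhoI) courant_diffU1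
  ?finset.setD11 //.
have rI' : courant N r \in [seq courant N r | r <- enum (I :\ rho)].
  by apply: map_f; rewrite mem_enum !inE rr.
apply: (diff_ops_invariant rI') => a.
by rewrite !hh' star_restrB star_restr_nonlink // subr0.
Qed.

Lemma difference_equations_of_star (I : {set rays Sigma}) :
  difference_equations h' -> rho \in I ->
  (~ spans_cone N I -> forall f, courant_diff I h f = 0) /\
  (spans_cone N I -> courant_diff I h 0 = 1).
Proof.
move=> [_ h'2 h'3] rhoI.
have [allI|[r [rI rr Sr]]] : (forall r, r \in I -> r != rho ->
  spans_cone N [set rho; r]%SET) \/
    exists r, [/\ r \in I, r != rho & ~ spans_cone N [set rho; r]%SET].
- have [|nall] := pselect (exists r, [/\ r \in I,
  r != rho & ~ spans_cone N [set rho; r]%SET]).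
    by right.
  by left=> r rI rr; apply: contrapT => Sr; apply: nall; exists r.
(* When all other rays of [I] are in the link, [I] corresponds to a set [J] of rays of the star.
   Otherwise the difference vanishes and [I] spans no cone, since its subset [{rho, r}] spans
   none. *)
- pose J : {set rays Sigma'} := [set q | down q \in I]%SET.
  have -> : I = (rho |: down @: J)%SET.
    apply/setP => r; rewrite !inE; case: eqP => [->//|/eqP rr] /=.
    apply/idP/imsetP => [rI|[q + ->]]; last by rewrite inE.
    have [q qE] := down_onto uf rr (allI r rI rr).
    by exists q; rewrite ?inE qE.
  split=> [nS f|/(spans_star uf) SJ]; rewrite courant_diff_star.
    by apply: h'2 => /(spans_star uf).
  by rewrite star_restr0; apply: h'3.
- split=> [_ f|SI]; first exact: courant_diff_nonlink rhoI rI rr Sr.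
  by case: Sr; apply: (spans_pair uf SI).
Qed.

(** The coordinates of [star_restr f] are linear in those of [f]. *)
Lemma polynomial_diff_of_star : polynomial_function h' ->
  polynomial_function (diff_op (courant N rho) h).
Proof.
move=> h'P; pose ev (i : 'I_#|{: rays Sigma}|) (f : PL N Sigma) :=
  f (prim N (val (enum_val i))).
have evr (r : rays Sigma) : polyfun ev (fun f => f (prim N (val r))).
  have evP : polyfun ev (fun f => ev (enum_rank r) f) by exact: polyfun_ev.
  by apply: polyfun_ext evP => f; rewrite /ev enum_rankK.
apply: (@polyfun_ext _ _ ev (fun f => h' (star_restr f))); first by move=> f;
  rewrite hh'.
pose ev' (j : 'I_#|{: rays Sigma'}|) (g : star_PL N rho) :=
  g (prim N' (val (enum_val j))).
apply: (@polyfun_comp _ _ _ _ ev ev' star_restr) h'P => j.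
apply: (@polyfun_ext _ _ ev (fun f => f (prim N (val (down (enum_val j))))
    + - (f (prim N (val rho)) * (dual_one (prim N (val (down (enum_val j)))) :
      rat)))).
  by move=> f; rewrite /ev' star_restrE.
apply: polyfunD; first exact: evr.
by apply: polyfunN; apply: polyfunM; [exact: evr|exact: polyfun_const].
Qed.

End Transfer.

End StarRestriction.

(** * The two implications *)

Lemma courant_diff0 (V : vectType rat) (N : set V) (Sigma : set (set V))
    (h : PL N Sigma -> rat) : courant_diff finset.set0 h = h.
Proof. by rewrite courant_diffE enum_set0. Qed.

Lemma no_rays_trivial_fan (V : vectType rat) (N : set V) (Sigma : set (set V)) :
  unimodular_fan N Sigma -> Sigma = [set [set 0]] -> rays Sigma -> False.
Proof.
move=> uf S0 r.
have r0 : [set [set 0]] (val r) by rewrite -S0; exact: (ray_Sigma uf).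
have := prim_neq0 uf r; have := prim_mem uf r.
by rewrite {1}(r0 : val r = [set 0]) => ->; rewrite eqxx.
Qed.

Lemma PL_trivial_fan (V : vectType rat) (N : set V) (Sigma : set (set V)) :
  unimodular_fan N Sigma -> Sigma = [set [set 0]] ->
  forall f g : PL N Sigma, f = g.
Proof. by move=> uf S0 f g; apply: (PL_ext uf) => r;
  case: (no_rays_trivial_fan uf S0 r). Qed.

(** Induction on the derivation of [ehrhart_function]. For nonempty [I], equations (ii) and (iii)
    are taken from the star of any ray in [I]; the empty set spans a cone and its equation is the
    normalization at 0. *)
Lemma ehrhart_difference_equations (V : vectType rat) (N : set V)
    (Sigma : set (set V)) (h : PL N Sigma -> int) :
  ehrhart_function h -> unimodular_fan N Sigma ->
  polynomial_function (fun f => (h f)%:~R) /\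
  difference_equations (fun f => (h f)%:~R : rat).
Proof.
elim=> {V N Sigma h} [V N Sigma h S0 h1|V N Sigma h h' S0 _ IH hM h1 hD] uf.
  split.
    by apply: polyfun_ext (polyfun_const _ 1) => f; rewrite h1.
  have I0 (I : {set rays Sigma}) : I = finset.set0.
    by apply/setP => r; case: (no_rays_trivial_fan uf S0 r).
  split=> [m _ f|I nI|I _]; first by rewrite /diff_op !h1 subrr.
    by case: nI; rewrite (I0 I); exact: (spans0 uf).
  by rewrite (I0 I) courant_diff0 h1.
have hh' rho f : diff_op (courant N rho) (fun f => (h f)%:~R : rat) f =
    (h' rho (star_restr rho f))%:~R.
  by rewrite /diff_op -rmorphB (hD _ _ _ (star_class_restr uf rho f)).
have {}IH rho := IH rho (star_unimodular uf rho).
split.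
  apply: (@polyfun_of_diff _ _ _ (fun i => courant N (enum_val i))) => //.
  - by move=> i f; apply: PL_int.
  - by move=> i j; rewrite (courantE uf) (inj_eq enum_val_inj).
  - move=> f; rewrite {1}(PL_decomp uf f).
    rewrite (reindex (enum_val : 'I_#|{: rays Sigma}| -> rays Sigma)) //.
    by apply: onW_bij; apply: enum_val_bij.
  - move=> i; have [IHp _] := IH (enum_val i).
    exact: (polynomial_diff_of_star uf (hh' _) IHp).
have eqs (I : {set rays Sigma}) rho (rI : rho \in I) :=
  difference_equations_of_star uf (hh' rho) (IH rho).2 rI.
split=> [m mN f|I nI f|I SI].
- by rewrite /diff_op -{1}(subrK (PL_of_dual N Sigma m) f) hM // subrr.
- have [I0|[rho rI]] := set_0Vmem I; last by have [+ _] := eqs I rho rI; apply.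
  by case: nI; rewrite I0; exact: (spans0 uf).
- have [->|[rho rI]] := set_0Vmem I; last by have [_ +] := eqs I rho rI; apply.
  by rewrite courant_diff0 h1.
Qed.

(** * Descent of a difference to the star *)

Section Descent.
Variables (V : vectType rat) (N : set V) (Sigma : set (set V)).
Hypothesis uf : unimodular_fan N Sigma.
Variable h : PL N Sigma -> rat.
Hypothesis hE : difference_equations h.
Variable rho : rays Sigma.

Local Notation N' := (quot_lattice N (u := prim N (val rho))).
Local Notation Sigma' := (star Sigma (val rho) (u := prim N (val rho))).
Local Notation down := (@down V N Sigma rho).
Let uf' := star_unimodular uf rho.

(** This is equation (ii) for the pair consisting of [rho] and [r]. *)
Lemma difference_nonlink_invariant r f : r != rho ->
  ~ spans_cone N [set rho; r]%SET ->
  diff_op (courant N rho) h (f - courant N r) = diff_op (courant N rho) h f.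
Proof.
have [_ h2 _] := hE => rr Sr; have := h2 _ Sr f.
rewrite courant_diffU1 ?inE 1?eq_sym // enum_set1 /= => /eqP.
by rewrite {1}/diff_op subr_eq0 => /eqP.
Qed.

Lemma dual_invariant m f : dual_lattice N m ->
  h (f - PL_of_dual N Sigma m) = h f.
Proof.
have [h1 _ _] := hE => mN; have /eqP := h1 m mN f.
by rewrite /diff_op subr_eq0 => /eqP.
Qed.

Lemma diff_dual_invariant m f : dual_lattice N m ->
  diff_op (courant N rho) h (f - PL_of_dual N Sigma m) =
    diff_op (courant N rho) h f.
Proof. by move=> mN; rewrite /diff_op addrAC !dual_invariant. Qed.

(* D_rho h is invariant under linear functions and under x_r for r outside the
   link of rho. *)
Lemma diff_star_class f f2 (g : star_PL N rho) : star_class f g ->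
  star_class f2 g ->
  diff_op (courant N rho) h f = diff_op (courant N rho) h f2.
Proof.
move=> /(star_classP uf)[m [mN mf mg]] /(star_classP uf)[m2 [m2N m2f m2g]].
(* After subtracting [m] and [m2], both functions vanish at [rho] and agree with [g] on the link.
   They differ only at the remaining rays, in whose directions the difference is invariant. *)
rewrite -(diff_dual_invariant _ mN) -(diff_dual_invariant f2 m2N).
apply/esym.
apply: (PL_courant_ind uf (S := (~: (rho |: down @: finset.setT))%SET)
  (P := fun f => diff_op (courant N rho) h f = _)) => [r f0|r|//].
  rewrite !inE negb_or => /andP[rr rl]; rewrite difference_nonlink_invariant //.
  by move=> /(down_onto uf rr)[q qE]; case/imsetP: rl; exists q.
rewrite !inE negbK !PL_B !(PL_of_dualE uf) //.
case/orP => [/eqP->|/imsetP[q _ ->]]; first by rewrite mf m2f !subrr.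
by rewrite -mg -m2g.
Qed.

(** Extension of [g] by zero at [rho] and outside the link: [down] is injective, so the sum has at
    most one term. *)
Definition star_lift (g : star_PL N rho) : PL N Sigma :=
  mkPL N (fun r => \sum_(q : rays Sigma' | down q == r) g (prim N' (val q))).

Lemma star_liftE g r : star_lift g (prim N (val r)) =
  \sum_(q : rays Sigma' | down q == r) g (prim N' (val q)).
Proof. by rewrite (mkPLE uf) // => r'; apply: rpred_sum => q _;
  apply: PL_int. Qed.

Lemma star_lift_rho g : star_lift g (prim N (val rho)) = 0.
Proof.
by rewrite star_liftE big_pred0 // => q; apply/negbTE/(down_neq uf).
Qed.

Lemma star_lift_down g (q : rays Sigma') :
  star_lift g (prim N (val (down q))) = g (prim N' (val q)).
Proof.
rewrite star_liftE (big_pred1 q) // => q'.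
by rewrite (inj_eq (down_inj uf (rho := rho))).
Qed.

Lemma star_class_lift g : star_class (star_lift g) g.
Proof.
apply/(star_classP uf); exists 0; split=> [v _||q].
- by rewrite zero_lfunE; exact: rpred0.
- by rewrite zero_lfunE star_lift_rho.
- by rewrite zero_lfunE subr0 star_lift_down.
Qed.

Definition star_descent (g : star_PL N rho) : rat :=
  diff_op (courant N rho) h (star_lift g).

Lemma star_descentE f g : star_class f g ->
  diff_op (courant N rho) h f = star_descent g.
Proof. by move=> fg; apply: diff_star_class fg (star_class_lift g). Qed.

(** Equation (i) comes from pulling the functional back to the original space. Equations (ii) and
    (iii) transfer through [courant_diff_star], as every [g] is the restriction of its lift. *)
Lemma star_descent_equations : difference_equations star_descent.
Proof.
have [_ h2 h3] := hE.
have hh' f : diff_op (courant N rho) h f = star_descent (star_restr rho f).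
  by apply: star_descentE; apply: star_class_restr.
have restr_lift g : star_restr rho (star_lift g) = g.
  apply: (PL_ext uf') => q.
  by rewrite (star_restrE uf) star_lift_rho mul0r subr0 star_lift_down.
split=> [m' m'N g|J nJ g|J SJ].
- pose m := (m' \o quot_hom (prim N (val rho)))%VF.
  have mE v : m v = m' (quot_hom (prim N (val rho)) v) by rewrite comp_lfunE.
  have mN : dual_lattice N m.
    by move=> v Nv; rewrite mE; apply: m'N; exists v; rewrite ?quot_homE.
  (* The pullback [m] vanishes at [rho], so translating the lift by [m] represents the translate of
     [g] by [m']. *)
  have cl : star_class (star_lift g - PL_of_dual N Sigma m)
    (g - PL_of_dual N' Sigma' m').
    apply/(star_classP uf); exists 0; split=> [v _||q].
    + by rewrite zero_lfunE; exact: rpred0.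
    + rewrite zero_lfunE PL_B star_lift_rho (PL_of_dualE uf) // mE quot_self.
      by rewrite linear0 subr0.
    + rewrite zero_lfunE subr0 !PL_B star_lift_down (PL_of_dualE uf) //.
      by rewrite (PL_of_dualE uf') // mE (prim_down uf).
  by rewrite {1}/diff_op -(star_descentE cl) diff_dual_invariant // subrr.
- rewrite -(restr_lift g) -(courant_diff_star uf hh'); apply: h2.
  by move/(spans_star uf).
- rewrite -(star_restr0 uf rho) -(courant_diff_star uf hh'); apply: h3.
  exact/(spans_star uf).
Qed.

End Descent.

(** Induction on the number of rays, which drops on passing to a star. *)
Lemma ehrhart_of_difference_equations (V : vectType rat) (N : set V)
    (Sigma : set (set V)) (h : PL N Sigma -> rat) :
  unimodular_fan N Sigma -> difference_equations h ->
  exists2 hZ : PL N Sigma -> int, ehrhart_function hZ &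
    forall f, h f = (hZ f)%:~R.
Proof.
have [n] := ubnP #|{: rays Sigma}|.
elim: n => // n IH in V N Sigma h *; rewrite ltnS => ltn uf hE.
have [h1 h2 h3] := hE.
have h0 : h 0 = 1 by rewrite -(courant_diff0 h); apply/h3/(spans0 uf).
have [S0|S0] := pselect (Sigma = [set [set 0]]).
  exists (fun=> 1); first exact: Ehrhart_dim0.
  by move=> f; rewrite (PL_trivial_fan uf S0 f 0) h0.
have star_ehrhart rho : exists hZ : star_PL N rho -> int, ehrhart_function hZ /\
    forall g, star_descent h g = (hZ g)%:~R.
  have [||hZ hZE hZP] := IH _ _ _ (star_descent h (rho := rho)) _
    (star_unimodular uf rho).
  - exact: leq_trans (card_rays_star uf rho) ltn.
  - exact: star_descent_equations.
  - by exists hZ.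
pose h' rho := projT1 (cid (star_ehrhart rho)).
have h'P rho : ehrhart_function (h' rho) /\
    forall g, star_descent h g = (h' rho g)%:~R.
  exact: projT2 (cid (star_ehrhart rho)).
(* The first differences are values of the integral Ehrhart functions of the stars, and [h 0] is
   1. *)
have hint f : h f \is a Num.int.
  apply: (diff_op_courant_int uf); first by rewrite h0.
  by move=> r g; rewrite (star_descentE uf hE (star_class_restr uf r g))
    (h'P r).2.
have hfloor f : (Num.floor (h f))%:~R = h f by rewrite floorK.
exists (fun f => Num.floor (h f)); last by move=> f; rewrite hfloor.
apply: (Ehrhart_dim_pos (h' := h')) => // [rho|m f mN||f rho g fg].
- exact: (h'P rho).1.
- by rewrite -(dual_invariant hE (f + _) mN) addrK.
- by rewrite h0 floor1.
- apply/eqP; rewrite -(eqr_int rat) intrB !hfloor -(h'P rho).2.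
  by rewrite -(star_descentE uf hE fg).
Qed.

Theorem proposition5p13 (V : vectType rat) (N : set V) (Sigma : set (set V)) :
  lattice N -> unimodular_fan N Sigma ->
  (Ehrhart N Sigma <->
   exists h : PL N Sigma -> rat,
     [/\ polynomial_function h,
         forall m, dual_lattice N m ->
           forall f, diff_op (PL_of_dual N Sigma m) h f = 0,
         forall I : {set rays Sigma}, ~ spans_cone N I ->
           forall f, courant_diff I h f = 0
       & forall I : {set rays Sigma}, spans_cone N I ->
           courant_diff I h 0 = 1]).
Proof.
move=> _ uf; split=> [[h hE]|[h [_ h1 h2 h3]]].
  exists (fun f => (h f)%:~R).
  by have [hP [h1 h2 h3]] := ehrhart_difference_equations hE uf.
have [//|hZ hZE _] := @ehrhart_of_difference_equations V N Sigma h uf.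
by exists hZ.
Qed.
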